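(* Let $\mathbb{F}$ be a field with $\mathrm{char}(\mathbb{F})\ne 2$, and let $C_4\rtimes C_4$ be the semidirect product (not direct) of two cyclic groups of order $4$, that is, $\langle a,b\mid a^4=b^4=1,\ bab^{-1}=a^{-1}\rangle$. Then $\beta(C_4\rtimes C_4)=7$.
   Context: For a finite group $G$, a $G$-module is a finite dimensional $\mathbb{F}$-vector space $V$ with a linear action of $G$. $S(V)$ is the symmetric algebra of $V$ (a polynomial algebra on a basis of $V$, with each variable of degree one), on which $G$ acts by $\mathbb{F}$-algebra automorphisms extending the action on $V$, and $S(V)^G$ is the subalgebra of $G$-invariants. $\beta(S(V)^G)$ is the minimal non-negative integer $d$ such that the $\mathbb{F}$-algebra $S(V)^G$ is generated by its homogeneous components of degree at most $d$. The Noether number is $\beta(G)=\sup\{\beta(S(V)^G): V \text{ is a } G\text{-module over }\mathbb{F}\}$. *)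

(* Defs.v *)
From mathcomp Require Import all_boot all_algebra all_fingroup all_solvable.
From mathcomp Require Import all_character.
From mathcomp Require Import mpoly.

Set Implicit Arguments.
Unset Strict Implicit.
Unset Printing Implicit Defensive.

Import GRing.Theory.
Local Open Scope ring_scope.

Definition is_least (P : nat -> Prop) (d : nat) : Prop :=
  P d /\ forall e : nat, P e -> (d <= e)%N.

(* [gen_subalg S] is the F-subalgebra of A generated by S. *)
Inductive gen_subalg (F : fieldType) (A : algType F) (S : A -> Prop) :
    A -> Prop :=
  | gen_subalg_in (x : A) : S x -> gen_subalg S x
  | gen_subalg_scalar (c : F) : gen_subalg S c%:A
  | gen_subalg_add (x y : A) :
      gen_subalg S x -> gen_subalg S y -> gen_subalg S (x + y)
  | gen_subalg_mul (x y : A) :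
      gen_subalg S x -> gen_subalg S y -> gen_subalg S (x * y).

Section Invariants.

Variables (F : fieldType) (gT : finGroupType) (G : {group gT}).
Variables (n : nat) (rG : mx_representation F G n).

(* The G-module V is the space of column vectors of height n on which g acts by
   v |-> rG g *m v. Its symmetric algebra S(V) is {mpoly F[n]}, the variable
   'X_j being the j-th vector of the standard basis of V, so that g maps 'X_j
   to the linear form given by the j-th column of rG g. *)
Definition sym_act (g : gT) (p : {mpoly F[n]}) : {mpoly F[n]} :=
  p \mPo [tuple \sum_(i < n) rG g i j *: 'X_i | j < n].

Definition sym_invariant (p : {mpoly F[n]}) : Prop :=
  forall g : gT, g \in G -> sym_act g p = p.

Definition low_degree_invariant (d : nat) (p : {mpoly F[n]}) : Prop :=
  sym_invariant p /\ exists2 k : nat, (k <= d)%N & p \is k.-homog.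

Definition invariants_generated_upto (d : nat) : Prop :=
  forall p : {mpoly F[n]},
    sym_invariant p -> gen_subalg (low_degree_invariant d) p.

(* [is_beta d] means beta(S(V)^G) = d. *)
Definition is_beta (d : nat) : Prop := is_least invariants_generated_upto d.

End Invariants.

(* [is_noether_number F G m] means beta(G) = m: m is the least upper bound, over
   all G-modules V over F, of the numbers beta(S(V)^G), each of which is
   required to exist (a module without one would count as infinite). *)
Definition is_noether_number (F : fieldType) (gT : finGroupType)
    (G : {group gT}) (m : nat) : Prop :=
  is_least (fun b : nat =>
    forall (n : nat) (rG : mx_representation F G n),
      exists2 d : nat, is_beta rG d & (d <= b)%N) m.

(* Main.v *)
Require Import Defs.
From HB Require Import structures.
From Stdlib Require Import Classical.
From mathcomp Require Import all_boot all_algebra all_fingroup all_solvable.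
From mathcomp Require Import all_character zify ring.
From mathcomp Require Import mpoly.

(** Write A for the abelian subgroup generated by a and b^2; it has index 2 and is
    isomorphic to C4 x C2.

    Upper bound. After a square root of -1 is adjoined, every linear form is a sum
    of weight vectors of A, and by the Reynolds operator the invariants of degree
    d are spanned by the sums u + b u, where u is an A-invariant product of d
    weight vectors, that is, a zero-sum sequence over C4 x C2. Let d be at least
    8 and work modulo products of invariants of lower degree. If u = u1 u2 with
    A-invariant factors, then moving u1 by b changes the sign of u + b u
    (B_transfer_flip); hence u + b u vanishes if u has three A-invariant factors
    (B_transfer_three). Call a weight odd if b does not fix it. If two odd weights
    in u are opposite to each other, they form an A-invariant factor, and as the
    Davenport constant of C4 x C2 is 5 the complement, of length at least 6, splits
    again: three factors. If u = u1 u2 with the same odd weight on both sides,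
    moving u1 by b leads to the previous case. If some of the weight vectors
    with even weight have a product invariant under the whole group, this product
    splits off from u + b u. A zero-sum sequence of length at least 8 always has
    one of these three forms (long_zero_sum_factors), because even terms without
    an invariant product number at most four, and four of them have all
    characters of the group as products of subfamilies (subsums4).

    The square root of -1 is harmless: the real and imaginary coordinates of an
    invariant of F[i] (x) S(V) are invariants of S(V).

    Lower bound. On the permutation module of the group, specialize the basis
    vectors to linear forms in two variables z and t over F[i], in such a way
    that a multiplies z by i, and that a and b multiply t by 1 and by i. In the
    image of an invariant, only exponents of z divisible by 4 occur, and at z = 0
    only exponents of t divisible by 4. Therefore the coefficient of z^4 t^3 of
    a product of two invariants involves only their constant terms and their own
    coefficients of z^4 t^3 (z4t3_coefM), and it vanishes on the algebra
    generated by the invariants of degree at most 6. It does not vanish on the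
    orbit sum of the monomial of degree 7 that is the product of the fourth power
    of the basis vector 1 and the cube of the basis vector b (z4t3_test). *)

Set Implicit Arguments.
Unset Strict Implicit.
Unset Printing Implicit Defensive.

Import GRing.Theory.

(** * Zero-sum sequences over C4 x C2 *)

Section ZeroSum.
Variables (X : eqType).
Implicit Types (k m : X -> nat) (s : seq X).

Lemma perm_mask_negb s b : size b = size s ->
  perm_eq s (mask b s ++ mask (map negb b) s).
Proof.
elim: s b => [|x s IHs] [|[] b] //= [/IHs sE]; first by rewrite perm_cons.
by rewrite perm_sym perm_catC /= perm_cons perm_sym (perm_trans sE) // perm_catC.
Qed.

(** Sums in C4 x C2, whose elements are encoded as pairs of reduced residues
    so that the check of all sequences of length 4 runs by computation. *)
Definition pair_sum (w : seq (nat * nat)) : nat * nat :=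
  foldr (fun x y => ((x.1 + y.1) %% 4, (x.2 + y.2) %% 2)) (0, 0) w.

Definition C4xC2 : seq (nat * nat) :=
  [seq (x, y) | x <- iota 0 4, y <- iota 0 2].

Fixpoint bitseqs n : seq bitseq :=
  if n is n'.+1 then [seq b :: w | b <- [:: true; false], w <- bitseqs n']
  else [:: [::]].

Definition subsums4_ok (w : seq (nat * nat)) : bool :=
  has (fun b => (pair_sum (mask b w) == (0, 0)) && has id b) (bitseqs 4) ||
  all (fun z => (z == (0, 0)) || has (fun b => pair_sum (mask b w) == z) (bitseqs 4))
    C4xC2.

Lemma subsums4_check :
  all (fun w1 => all (fun w2 => all (fun w3 => all (fun w4 =>
    subsums4_ok [:: w1; w2; w3; w4]) C4xC2) C4xC2) C4xC2) C4xC2.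
Proof. by vm_compute. Qed.

Lemma pair_sum_map k m s :
  pair_sum [seq (k x %% 4, m x %% 2) | x <- s] =
  ((\sum_(x <- s) k x) %% 4, (\sum_(x <- s) m x) %% 2).
Proof.
by elim: s => [|x s /= ->]; rewrite ?big_nil ?big_cons //= !modnDm.
Qed.

(** A zero-sum free sequence of length 4 over C4 x C2 is extremal: its
    subsums exhaust the group. The residues of k modulo 4 and of m modulo 2
    are the two coordinates of a term. *)
Lemma subsums4 k m s : size s = 4 ->
  (exists s1 s2, [/\ perm_eq s (s1 ++ s2), 0 < size s1,
     4 %| \sum_(x <- s1) k x & 2 %| \sum_(x <- s1) m x]) \/
  (forall a b, ~~ ((4 %| a) && (2 %| b)) -> exists s1 s2,
     [/\ perm_eq s (s1 ++ s2), \sum_(x <- s1) k x = a %[mod 4]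
       & \sum_(x <- s1) m x = b %[mod 2]]).
Proof.
case: s => [|x1 [|x2 [|x3 [|x4 [|? ?]]]]] // _; set s := [:: x1; x2; x3; x4].
have C4xC2P c d : (c %% 4, d %% 2) \in C4xC2.
  by apply: allpairs_f; rewrite mem_iota /= add0n ltn_pmod.
have: subsums4_ok [seq (k x %% 4, m x %% 2) | x <- s].
  exact: (allP (allP (allP (allP subsums4_check _ (C4xC2P (k x1) (m x1)))
    _ (C4xC2P (k x2) (m x2))) _ (C4xC2P (k x3) (m x3))) _ (C4xC2P (k x4) (m x4))).
have bits_size b : b \in (bitseqs 4) -> size b = size s.
  have/allP bs : all (fun b => size b == 4) (bitseqs 4) by vm_compute.
  by move/bs/eqP.
case/orP=> [/hasP[b b_in]|/allP all_sums].
  rewrite -map_mask pair_sum_map => /andP[/eqP[k0 m0] b_has]; left.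
  exists (mask b s), (mask (map negb b) s); split.
  - exact/perm_mask_negb/bits_size.
  - by rewrite size_mask ?bits_size // -has_count.
  - exact/eqP.
  - exact/eqP.
right=> c d cd; have:= all_sums _ (C4xC2P c d).
rewrite xpair_eqE -/(dvdn 4 c) -/(dvdn 2 d) (negbTE cd) orFb.
case/hasP=> b b_in; rewrite -map_mask pair_sum_map => /eqP[kc md].
exists (mask b s), (mask (map negb b) s); split=> //.
exact/perm_mask_negb/bits_size.
Qed.

(** The Davenport constant of C4 x C2 is 5. Either the last four of five terms
    have a zero subsum, or one of their subsums is the opposite of the first
    term. *)
Lemma zero_subsum5 k m s : 4 < size s ->
  exists s1 s2, [/\ perm_eq s (s1 ++ s2), 0 < size s1, size s1 <= 5,
     4 %| \sum_(x <- s1) k x & 2 %| \sum_(x <- s1) m x].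
Proof.
case: s => [|x0 [|x1 [|x2 [|x3 [|x4 r]]]]] // _.
set s := [:: x1; x2; x3; x4]; rewrite -[_ :: _]/(x0 :: s ++ r).
have sub_size s1 s2 : perm_eq s (s1 ++ s2) -> size s1 <= 4.
  by move/perm_size; rewrite size_cat /= => ->; rewrite leq_addr.
have [x0_0 | x0_n0] := boolP ((4 %| k x0) && (2 %| m x0)).
  case/andP: x0_0 => k0 m0; exists [:: x0], (s ++ r).
  by rewrite !big_seq1.
case: (subsums4 k m (erefl (size s))) => [[s1 [s2 [sE s1_gt0 k0 m0]]]|sums].
  exists s1, (s2 ++ x0 :: r); split=> //; last exact/leqW/sub_size/sE.
  by apply/seq.permP=> f; have:= seq.permP sE f; rewrite /= !count_cat /=; lia.
have [|s1 [s2 [sE k1 m1]]] := sums (3 * k x0) (m x0).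
  by apply: contra x0_n0; lia.
exists (x0 :: s1), (s2 ++ r); rewrite /= !big_cons; split=> //; last 3 first.
- by rewrite ltnS (sub_size _ _ sE).
- by move: k1; lia.
- by move: m1; lia.
by apply/seq.permP=> f; have:= seq.permP sE f; rewrite /= !count_cat /=; lia.
Qed.

End ZeroSum.

(** * Factorizations of long zero-sum sequences *)

Section Factorizations.
Variables (X : eqType) (k m : X -> nat).
Implicit Types (s : seq X).

(** The terms x of a sequence stand for variables with the weight
    (k x mod 4, m x mod 2) under the subgroup of order 8 generated by a and b^2.
    The element b negates the first coordinate, so that the terms with k x odd
    come in pairs of exchanged weights, while a term with k x even is fixed by
    b up to a scalar recorded by m x mod 4.

    The three configurations below are those that let an invariant be
    decomposed. In a mixed pair, x and y have opposite odd weights. *)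
Definition mixed_pair s := exists x y r, [/\ perm_eq s (x :: y :: r),
  odd (k x) && odd (k y), 4 %| k x + k y & 2 %| m x + m y].

(** The sequence splits into two zero-sum parts that share an odd weight. *)
Definition split_class s := exists x y s1 s2,
  [/\ perm_eq s ((x :: s1) ++ y :: s2),
    [&& odd (k x), k x == k y %[mod 4] & m x == m y %[mod 2]],
    4 %| \sum_(z <- x :: s1) k z & 2 %| \sum_(z <- x :: s1) m z].

(** The part s1 is the weight sequence of a product invariant under the whole
    group, not only under its subgroup of index 2. *)
Definition even_factor s := exists s1 s2,
  [/\ perm_eq s (s1 ++ s2), 0 < size s1, 0 < size s2,
    all (fun x => ~~ odd (k x)) s1 &
    (4 %| \sum_(x <- s1) k x) && (4 %| \sum_(x <- s1) m x)].

Lemma sum_even_half s : all (fun x => ~~ odd (k x)) s ->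
  \sum_(x <- s) k x = 2 * \sum_(x <- s) (k x)./2.
Proof.
elim: s => [|x s IHs] /=; first by rewrite !big_nil.
case/andP=> kx /IHs; rewrite !big_cons => ->.
by rewrite mulnDr [2 * _./2]mul2n even_halfK.
Qed.

Lemma sum_odd s : all (fun x => odd (k x)) s ->
  odd (\sum_(x <- s) k x) = odd (size s).
Proof.
elim: s => [|x s IHs] /=; first by rewrite !big_nil.
by case/andP=> kx /IHs; rewrite big_cons oddD kx => ->.
Qed.

Lemma even_factorI s E O s1 s2 : perm_eq s (O ++ E) ->
  all (fun x => ~~ odd (k x)) E -> perm_eq E (s1 ++ s2) ->
  0 < size s1 -> size s1 < size s ->
  4 %| \sum_(x <- s1) m x -> 2 %| \sum_(x <- s1) (k x)./2 -> even_factor s.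
Proof.
move=> sOE E_even E12 s1_gt0 s1_lt m1 k1; exists s1, (s2 ++ O).
have sE12 : perm_eq s (s1 ++ s2 ++ O).
  by rewrite (perm_trans sOE) // perm_catC catA perm_cat2r.
have s1_even : all (fun x => ~~ odd (k x)) s1.
  by move: E_even; rewrite (perm_all _ E12) all_cat => /andP[].
split=> //.
  by move: s1_lt; rewrite (perm_size sE12) size_cat -ltn_subLR // subnn.
by rewrite m1 sum_even_half // -[4]/(2 * 2) dvdn_pmul2l // k1.
Qed.

Definition in_class a c x :=
  [&& odd (k x), k x == a %[mod 4] & m x == c %[mod 2]].

(** For fixed parity of m, two odd weights are either equal or opposite. *)
Lemma mixed_pair_or_class c s s' r : perm_eq s (s' ++ r) ->
  all (fun x => odd (k x) && (m x == c %[mod 2])) s' ->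
  mixed_pair s \/ exists a, all (in_class a c) s'.
Proof.
case: s' => [|x s'] ss'r /=; first by right; exists 0.
case/andP=> /andP[ox mx] s_ok.
have [/allP sx | /allPn[y ys kxy]] := boolP (all (fun y => k y == k x %[mod 4]) s').
  right; exists (k x); rewrite /in_class ox eqxx mx /=.
  by apply/allP=> y ys; have /andP[-> ->] := allP s_ok y ys; rewrite sx.
have /andP[oy my] := allP s_ok y ys; left; exists x, y, (rem y s' ++ r); split.
- by rewrite (perm_trans ss'r) //= perm_cons -cat_cons perm_cat2r perm_to_rem.
- by rewrite ox.
- by clear -kxy ox oy; lia.
- by clear -mx my; lia.
Qed.

(** Four equal odd weights have sum zero, and so have two weights (k, m) taken
    twice together with two weights (k', m') taken twice, since 2k + 2k' is
    divisible by 4. With at least six odd terms, one of these two patterns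
    leaves behind a further copy of one of its weights. *)
Lemma split_class_many s P Q E a b c d :
  perm_eq s (P ++ Q ++ E) -> all (in_class a c) P -> all (in_class b d) Q ->
  ~~ odd (size P + size Q) -> 4 < size P + size Q -> split_class s.
Proof.
wlog: P Q a b c d / size Q <= size P => [th|QleP] sPQE Pac Qbd PQ_even PQ_gt4.
  have /orP[QP|PQ] := leq_total (size Q) (size P); first exact: (th P Q a b c d).
  apply: (th Q P b a d c) => //; try by rewrite addnC.
  by rewrite (perm_trans sPQE) // perm_catCA.
have [P_ge5 | P_le4] := ltnP 4 (size P).
  case: P P_ge5 sPQE Pac {PQ_even PQ_gt4 QleP} =>
    [|x1 [|x2 [|x3 [|x4 [|x5 P]]]]] //= _ sPQE.
  case/and5P=> /and3P[? ? ?] /and3P[? ? ?] /and3P[? ? ?] /and3P[? ? ?].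
  case/andP=> /and3P[? ? ?] _.
  exists x1, x5, [:: x2; x3; x4], (P ++ Q ++ E).
  by clear Qbd; split; [exact: sPQE | | rewrite !big_cons big_nil..];
    clear sPQE; lia.
have : 1 < size Q by clear -PQ_even PQ_gt4 P_le4; lia.
have : 2 < size P by clear -PQ_gt4 QleP; lia.
case: P Q sPQE Pac Qbd {PQ_even PQ_gt4 QleP P_le4} =>
  [|x1 [|x2 [|x3 P]]] // [|y1 [|y2 Q]] //= sPQE.
case/and4P=> /and3P[? ? ?] /and3P[? ? ?] /and3P[? ? ?] _.
case/and3P=> /and3P[? ? ?] /and3P[? ? ?] _ _ _.
exists x1, x3, [:: x2; y1; y2], (P ++ Q ++ E).
split; [ | | rewrite !big_cons big_nil..]; try by clear sPQE; lia.
apply/seq.permP=> f; rewrite (seq.permP sPQE) /= !count_cat /= !count_cat.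
by clear; lia.
Qed.

(** Even terms live in the group C2 x C4 of the characters of the whole group,
    with coordinates (k/2 mod 2, m mod 4); when their subsums exhaust it, they
    can complete any pair of odd terms that is not already zero-sum. *)
Lemma complete_odd_pair x y s :
  all (fun z => ~~ odd (k z)) s -> odd (k x) -> odd (k y) ->
  (forall a b, ~~ ((4 %| a) && (2 %| b)) -> exists s1 s2,
     [/\ perm_eq s (s1 ++ s2), \sum_(z <- s1) m z = a %[mod 4]
       & \sum_(z <- s1) (k z)./2 = b %[mod 2]]) ->
  ~~ ((4 %| k x + k y) && (2 %| m x + m y)) ->
  exists s1 s2, [/\ perm_eq s (s1 ++ s2),
    4 %| \sum_(z <- x :: y :: s1) k z & 2 %| \sum_(z <- x :: y :: s1) m z].
Proof.
move=> s_even ox oy sums xy_n0.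
have [|s1 [s2 [sE s1m s1k]]] := sums ((m x + m y) %% 2) ((k x + k y)./2).
  by apply: contra xy_n0; clear -ox oy; lia.
exists s1, s2; rewrite !big_cons sum_even_half; last first.
  by move: s_even; rewrite (perm_all _ sE) all_cat => /andP[].
by split=> //; clear -ox oy s1m s1k; lia.
Qed.

(** With four odd terms, a pair of odd terms is chosen so that the other
    two still contain one of its weights, and is completed by even terms. *)
Lemma split_class_four s P Q E a b c d :
  perm_eq s (P ++ Q ++ E) -> all (in_class a c) P -> all (in_class b d) Q ->
  c != d %[mod 2] -> size P + size Q = 4 -> all (fun z => ~~ odd (k z)) E ->
  (forall a b, ~~ ((4 %| a) && (2 %| b)) -> exists s1 s2,
     [/\ perm_eq E (s1 ++ s2), \sum_(z <- s1) m z = a %[mod 4]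
       & \sum_(z <- s1) (k z)./2 = b %[mod 2]]) ->
  split_class s.
Proof.
wlog: P Q a b c d / size Q <= size P => [th|QleP] sPQE Pac Qbd cd PQ4 E_even sums.
  have /orP[QP|PQ] := leq_total (size Q) (size P); first exact: (th P Q a b c d).
  apply: (th Q P b a d c) => //; [|by rewrite eq_sym|by rewrite addnC].
  by rewrite (perm_trans sPQE) // perm_catCA.
have [P_ge3 | P_le2] := ltnP 2 (size P).
  case: P P_ge3 sPQE Pac {PQ4 QleP} => [|x1 [|x2 [|x3 P]]] //= _ sPQE.
  case/and4P=> /and3P[x1_odd ? ?] /and3P[x2_odd ? ?] /and3P[? ? ?] _.
  have [|E1 [E2 [E12 kE1 mE1]]] := complete_odd_pair E_even x1_odd x2_odd sums.
    by clear sPQE sums; lia.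
  exists x1, x3, (x2 :: E1), (P ++ Q ++ E2); split=> //.
    apply/seq.permP=> f; have:= seq.permP sPQE f; have:= seq.permP E12 f.
    by rewrite /= !count_cat /= ?count_cat /= ?count_cat; clear; lia.
  by clear sPQE sums E12 kE1 mE1; lia.
case: P Q PQ4 QleP P_le2 sPQE Pac Qbd => [|x1 [|x2 [|? ?]]] // [|y1 [|y2 Q]] //=.
move=> _ _ _ sPQE /and3P[/and3P[x1_odd ? ?] /and3P[? ? ?] _].
case/andP=> /and3P[y1_odd ? ?] _.
have [|E1 [E2 [E12 kE1 mE1]]] := complete_odd_pair E_even x1_odd y1_odd sums.
  by clear sPQE sums; lia.
exists x1, x2, (y1 :: E1), (y2 :: Q ++ E2); split=> //.
  apply/seq.permP=> f; have:= seq.permP sPQE f; have:= seq.permP E12 f.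
  by rewrite /= !count_cat /= ?count_cat /= ?count_cat; clear; lia.
by clear sPQE sums E12 kE1 mE1; lia.
Qed.

(** Five even terms already contain an even factor. Otherwise at least four
    terms are odd, an even number in any case. More than four split by themselves;
    if there are exactly four, then there are four even terms, which either are
    not zero-sum free or have all subsums available. *)
Lemma long_zero_sum_factors s : 8 <= size s ->
  4 %| \sum_(x <- s) k x -> 2 %| \sum_(x <- s) m x ->
  [\/ mixed_pair s, split_class s | even_factor s].
Proof.
move=> s_ge8 ks ms.
pose E := [seq x <- s | ~~ odd (k x)]; pose O := [seq x <- s | odd (k x)].
pose P := [seq x <- O | ~~ odd (m x)]; pose Q := [seq x <- O | odd (m x)].
have sOE : perm_eq s (O ++ E) by rewrite perm_sym perm_filterC.
have OPQ : perm_eq O (P ++ Q) by rewrite perm_sym perm_catC perm_filterC.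
have sPQE : perm_eq s (P ++ Q ++ E).
  by rewrite catA (perm_trans sOE) // perm_cat2r.
have sQPE : perm_eq s (Q ++ P ++ E) by rewrite (perm_trans sPQE) // perm_catCA.
have E_even : all (fun x => ~~ odd (k x)) E by exact: filter_all.
have P_ok : all (fun x => odd (k x) && (m x == 0 %[mod 2])) P.
  by apply/allP=> x; rewrite !mem_filter modn2 => /and3P[/negbTE-> ->].
have Q_ok : all (fun x => odd (k x) && (m x == 1 %[mod 2])) Q.
  by apply/allP=> x; rewrite !mem_filter modn2 => /and3P[-> ->].
have [mixP | [a Pa]] := mixed_pair_or_class sPQE P_ok; first by constructor 1.
have [mixQ | [b Qb]] := mixed_pair_or_class sQPE Q_ok; first by constructor 1.
have size_s : size s = size P + size Q + size E.
  by rewrite (perm_size sPQE) !size_cat addnA.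
have [E_ge5 | E_le4] := ltnP 4 (size E).
  have [s1 [s2 [E12 s1_gt0 s1_le5 m1 k1]]] := zero_subsum5 m (fun x => (k x)./2) E_ge5.
  constructor 3; apply: (even_factorI sOE E_even E12 _ _ m1 k1) => //.
  by apply: leq_trans s_ge8; apply: leq_ltn_trans s1_le5 _.
have PQ_even : ~~ odd (size P + size Q).
  rewrite -size_cat -(perm_size OPQ) -sum_odd; last exact: filter_all.
  move: ks; rewrite (perm_big _ sOE) big_cat /= (sum_even_half E_even); clear; lia.
have [PQ_gt4 | PQ_le4] := ltnP 4 (size P + size Q).
  by constructor 2; exact: split_class_many sPQE Pa Qb PQ_even PQ_gt4.
have [PQ4 E4] : size P + size Q = 4 /\ size E = 4.
  by clear -size_s s_ge8 PQ_le4 E_le4; lia.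
case: (subsums4 m (fun x => (k x)./2) E4) => [[s1 [s2 [E12 s1_gt0 m1 k1]]]|sums].
  constructor 3; apply: (even_factorI sOE E_even E12 _ _ m1 k1) => //.
  have := perm_size E12; rewrite size_cat E4 => s12; apply: leq_trans s_ge8.
  by clear -s12; lia.
by constructor 2; apply: (split_class_four sPQE Pa Qb _ PQ4 E_even sums).
Qed.

End Factorizations.

Local Open Scope ring_scope.

(** * Decomposing invariants of degree at least 8 *)

(** The setting abstracts the symmetric algebra with a square root j of -1
    adjoined: alpha and beta are the actions of the generators a and b, H d is
    the space of forms of degree d, h is one half, and B is the subalgebra
    generated by the invariants of degree at most 7. No basis of weight vectors
    is needed: forms of positive degree are sums of products of linear forms
    (H_span), and every linear form is a sum of weight vectors. *)
Section DegreeSeven.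

Variables (T : comNzRingType) (j h : T) (alpha beta : {rmorphism T -> T}).
Variables (H : nat -> T -> Prop) (B : T -> Prop).

Hypothesis jj : j * j = -1.
Hypothesis hh : h + h = 1.
Hypothesis alpha_j : alpha j = j.
Hypothesis beta_j : beta j = j.
Hypothesis alpha4 : forall u, alpha (alpha (alpha (alpha u))) = u.
Hypothesis beta4 : forall u, beta (beta (beta (beta u))) = u.
Hypothesis alpha_beta_alpha : forall u, alpha (beta (alpha u)) = beta u.

Hypothesis H_1 : H 0 1.
Hypothesis H_add : forall d u v, H d u -> H d v -> H d (u + v).
Hypothesis H_mul : forall d e u v, H d u -> H e v -> H (d + e) (u * v).
Hypothesis H_j : forall d u, H d u -> H d (j * u).
Hypothesis H_h : forall d u, H d u -> H d (h * u).
Hypothesis H_alpha : forall d u, H d u -> H d (alpha u).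
Hypothesis H_beta : forall d u, H d u -> H d (beta u).
Hypothesis H_span : forall d (P : T -> Prop), P 0 ->
  (forall u v, P u -> P v -> P (u + v)) ->
  (forall s : seq T, size s = d.+1 -> {in s, forall l, H 1 l} ->
     P (\prod_(l <- s) l)) ->
  forall u, H d.+1 u -> P u.

Hypothesis B_add : forall u v, B u -> B v -> B (u + v).
Hypothesis B_mul : forall u v, B u -> B v -> B (u * v).
Hypothesis B_j : B j.
Hypothesis B_h : B h.

Definition invariant u := alpha u = u /\ beta u = u.

Hypothesis B_low : forall d u, (d <= 7)%N -> H d u -> invariant u -> B u.

Lemma B_opp u : B u -> B (- u).
Proof.
have -> : - u = j * j * u by rewrite jj mulN1r.
by move=> Bu; apply: B_mul => //; apply: B_mul.
Qed.

Lemma B_0 : B 0.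
Proof. by rewrite -(subrr j); apply: B_add => //; apply: B_opp. Qed.

Lemma B_half u : B (u + u) -> B u.
Proof.
move=> Buu; have -> : u = h * (u + u) by rewrite mulrDr -mulrDl hh mul1r.
exact: B_mul.
Qed.

Lemma H_opp d u : H d u -> H d (- u).
Proof.
have -> : - u = j * (j * u) by rewrite mulrA jj mulN1r.
by move=> Hu; do 2!apply: H_j.
Qed.

Lemma j4 : j ^+ 4 = 1.
Proof. by rewrite -[4%N]/(2 * 2)%N exprM -[j ^+ 2]/(j * j) jj sqrrN expr1n. Qed.

Lemma jX_mod k l : k = l %[mod 4] -> j ^+ k = j ^+ l.
Proof. by move=> kl; rewrite -(expr_mod k j4) kl expr_mod // j4. Qed.

Lemma jX_double k : j ^+ (2 * k) = (-1) ^+ k.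
Proof. by rewrite exprM -[j ^+ 2]/(j * j) jj. Qed.

Lemma morph_h (f : {rmorphism T -> T}) : f h = h.
Proof.
have: f h + f h = 1 by rewrite -rmorphD hh rmorph1.
move=> fhh; rewrite -[LHS]mul1r -hh mulrDl -mulrDr fhh; exact: mulr1.
Qed.

(** The four summands are the projections of x to the eigenspaces of f for the
    eigenvalues 1, j, -1 and -j; they stay in any predicate P closed under
    f and linear combinations with coefficients in Z[j, h]. *)
Lemma eigen4 (f : {rmorphism T -> T}) (P : T -> Prop) x :
  f j = j -> (forall u, f (f (f (f u))) = u) ->
  (forall u v, P u -> P v -> P (u + v)) -> (forall u, P u -> P (j * u)) ->
  (forall u, P u -> P (h * u)) -> (forall u, P u -> P (f u)) -> P x ->
  exists y : nat -> T, x = y 0%N + y 1%N + y 2%N + y 3%N /\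
    forall k, (k < 4)%N -> P (y k) /\ f (y k) = j ^+ k * y k.
Proof.
move=> fj f4 Padd Pj Ph Pf Px.
have Popp u : P u -> P (- u).
  by move=> Pu; rewrite -mulN1r -jj -mulrA; apply/Pj/Pj.
have fh := morph_h f.
have [Pa Pb Pc] : [/\ P (f x), P (f (f x)) & P (f (f (f x)))].
  by split; [exact: Pf | exact/Pf/Pf | exact/Pf/Pf/Pf].
exists (fun k => h * (h * nth 0 [:: x + f x + f (f x) + f (f (f x));
  x + - (j * f x) + - f (f x) + j * f (f (f x));
  x + - f x + f (f x) + - f (f (f x));
  x + j * f x + - f (f x) + - (j * f (f (f x)))] k)).
split=> /=; first by rewrite -[LHS]mul1r -[X in X * _ = _]mul1r -{1 2}hh; ring.
case=> [|[|[|[|//]]]] _ /=.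
- split; first by apply/Ph/Ph; do 3?apply: (Padd) => //.
  by rewrite !rmorphM !rmorphD /= f4 fh expr0; ring.
- split.
    by apply/Ph/Ph; do 3?apply: (Padd) => //; do ?apply: Popp; do ?apply: Pj.
  rewrite !(rmorphM, rmorphD, rmorphN) /= f4 fh fj expr1.
  apply/eqP; rewrite -subr_eq0; apply/eqP.
  transitivity (h * h * ((j * j + 1) * (f x - f (f (f x))))); first by ring.
  by rewrite jj addrC subrr mul0r mulr0.
- split; first by apply/Ph/Ph; do 3?apply: (Padd) => //; do ?apply: Popp.
  by rewrite !(rmorphM, rmorphD, rmorphN) /= f4 fh expr2 jj; ring.
split; first by apply/Ph/Ph; do 3?apply: (Padd) => //; do ?apply: Popp; do ?apply: Pj.
rewrite !(rmorphM, rmorphD, rmorphN) /= f4 fh fj exprS expr2 jj.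
apply/eqP; rewrite -subr_eq0; apply/eqP.
transitivity (h * h * ((j * j + 1) * (f x - f (f (f x))))); first by ring.
by rewrite jj addrC subrr mul0r mulr0.
Qed.

(** A factor is a linear form together with the exponents of its weight. *)
Local Notation factor := (nat * nat * T)%type.

Definition weight_a (x : factor) : nat := x.1.1.
Definition weight_b (x : factor) : nat := x.1.2.

(** For odd exponents of alpha only the square of beta preserves the eigenspace,
    so that the second exponent refers to beta^2 there and to beta otherwise. In
    both cases beta^2 acts by the sign given by the parity of weight_b. *)
Definition weight_vector (x : factor) : Prop :=
  [/\ H 1 x.2, alpha x.2 = j ^+ weight_a x * x.2 &
    if odd (weight_a x) then beta (beta x.2) = (-1) ^+ weight_b x * x.2
    else beta x.2 = j ^+ weight_b x * x.2].

(** As beta conjugates alpha to its inverse, it exchanges the eigenvalues j^k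
    and j^(-k) = j^(3k). *)
Lemma alpha_beta_eigen k u : alpha u = j ^+ k * u ->
  alpha (beta u) = j ^+ (3 * k) * beta u.
Proof.
move=> uk; have := alpha_beta_alpha u.
rewrite uk !rmorphM !rmorphXn /= beta_j alpha_j => {2}<-.
by rewrite mulrA -exprD -mulSnr exprM j4 expr1n mul1r.
Qed.

Lemma weight_decomposition_eigen k u : H 1 u -> alpha u = j ^+ k * u ->
  exists xs : seq factor,
    {in xs, forall x, weight_vector x} /\ u = \sum_(x <- xs) x.2.
Proof.
move=> Hu uk.
have beta2_uk : alpha (beta (beta u)) = j ^+ k * beta (beta u).
  rewrite (alpha_beta_eigen (alpha_beta_eigen uk)); congr (_ * _).
  by apply: jX_mod; lia.
have [k_odd | k_even] := boolP (odd k).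
  exists [:: (k, 0%N, h * (u + beta (beta u))); (k, 1%N, h * (u - beta (beta u)))].
  split; last by rewrite big_cons big_seq1 /= -[LHS]mul1r -hh; ring.
  move=> x; rewrite !inE => /orP[] /eqP-> /=;
    rewrite /weight_vector /weight_a /weight_b /= k_odd.
    split; first by apply/H_h/H_add => //; do 2!apply: H_beta.
      by rewrite rmorphM rmorphD (morph_h alpha) beta2_uk uk; ring.
    by rewrite !rmorphM !rmorphD /= !(morph_h beta) beta4; ring.
  split; first by apply/H_h/H_add => //; apply: H_opp; do 2!apply: H_beta.
    by rewrite rmorphM rmorphB (morph_h alpha) beta2_uk uk; ring.
  by rewrite !rmorphM !rmorphB /= !(morph_h beta) beta4; ring.
pose P v := H 1 v /\ alpha v = j ^+ k * v.
have [||||//|v [-> v_ok]] := @eigen4 beta P u beta_j beta4.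
- by move=> v w [Hv vk] [Hw wk]; split; [exact: H_add | rewrite rmorphD vk wk mulrDr].
- by move=> v [Hv vk]; split; [exact: H_j | rewrite rmorphM alpha_j vk mulrCA].
- by move=> v [Hv vk]; split; [exact: H_h | rewrite rmorphM (morph_h alpha) vk mulrCA].
- move=> v [Hv vk]; split; first exact: H_beta.
  by rewrite (alpha_beta_eigen vk); congr (_ * _); apply: jX_mod; lia.
exists [seq (k, i, v i) | i <- iota 0%N 4%N]; split.
  move=> x /mapP[i]; rewrite mem_iota => /andP[_ /v_ok[[Hv vk] vi]] ->.
  by rewrite /weight_vector /weight_a /weight_b /= (negbTE k_even).
by rewrite big_map !big_cons big_nil /= addr0 !addrA.
Qed.

Lemma weight_decomposition u : H 1 u ->
  exists xs : seq factor,
    {in xs, forall x, weight_vector x} /\ u = \sum_(x <- xs) x.2.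
Proof.
move=> Hu; have [v [-> v_ok]] :=
  eigen4 alpha_j alpha4 (@H_add 1) (@H_j 1) (@H_h 1) (@H_alpha 1) Hu.
have dec k : (k < 4)%N -> _ := fun k4 => let: conj Hv vk := v_ok k k4 in
  weight_decomposition_eigen Hv vk.
have [xs0 [xs0_ok ->]] := dec 0%N isT; have [xs1 [xs1_ok ->]] := dec 1%N isT.
have [xs2 [xs2_ok ->]] := dec 2%N isT; have [xs3 [xs3_ok ->]] := dec 3%N isT.
exists (xs0 ++ xs1 ++ xs2 ++ xs3); rewrite !big_cat /= !addrA; split=> // x.
by rewrite !mem_cat => /or4P[/xs0_ok|/xs1_ok|/xs2_ok|/xs3_ok].
Qed.

Definition monomial (s : seq factor) : T := \prod_(x <- s) x.2.

Definition weights (s : seq factor) := {in s, forall x, weight_vector x}.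

Lemma weights_cat s1 s2 : weights (s1 ++ s2) -> weights s1 /\ weights s2.
Proof. by move=> ws; split=> x xs; apply: ws; rewrite mem_cat xs ?orbT. Qed.

Lemma weights_cons x s : weights (x :: s) -> weight_vector x /\ weights s.
Proof.
by move=> ws; split=> [|y ys]; apply: ws; rewrite in_cons ?eqxx // ys orbT.
Qed.

Lemma perm_weights s1 s2 : perm_eq s1 s2 -> weights s1 -> weights s2.
Proof. by move=> s12 ws x; rewrite -(perm_mem s12); apply: ws. Qed.

Lemma monomial_perm s1 s2 : perm_eq s1 s2 -> monomial s1 = monomial s2.
Proof. exact: perm_big. Qed.

Lemma monomial_cat s1 s2 : monomial (s1 ++ s2) = monomial s1 * monomial s2.
Proof. exact: big_cat. Qed.

Lemma monomial_cons x s : monomial (x :: s) = x.2 * monomial s.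
Proof. exact: big_cons. Qed.

Lemma H_monomial s : weights s -> H (size s) (monomial s).
Proof.
elim: s => [|x s IHs] ws; first by rewrite /monomial big_nil.
have [[Hx _ _] /IHs Hs] := weights_cons ws.
by rewrite monomial_cons -[size _]add1n; apply: H_mul.
Qed.

Lemma alpha_monomial s : weights s ->
  alpha (monomial s) = j ^+ (\sum_(x <- s) weight_a x) * monomial s.
Proof.
elim: s => [|x s IHs] ws; first by rewrite /monomial !big_nil rmorph1 mulr1.
have [[_ ax _] /IHs as_] := weights_cons ws.
by rewrite monomial_cons rmorphM ax as_ big_cons exprD mulrACA.
Qed.

Lemma beta2_weight x : weight_vector x -> beta (beta x.2) = (-1) ^+ weight_b x * x.2.
Proof.
case=> _ _; case: ifP => // _ bx.
by rewrite bx rmorphM rmorphXn /= beta_j bx mulrA -exprD addnn -mul2n jX_double.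
Qed.

Lemma beta2_monomial s : weights s ->
  beta (beta (monomial s)) = (-1) ^+ (\sum_(x <- s) weight_b x) * monomial s.
Proof.
elim: s => [|x s IHs] ws; first by rewrite /monomial !big_nil !rmorph1 mulr1.
have [/beta2_weight bx /IHs bs] := weights_cons ws.
by rewrite monomial_cons !rmorphM /= bx bs big_cons exprD mulrACA.
Qed.

Lemma beta_monomial_even s : weights s -> all (fun x => ~~ odd (weight_a x)) s ->
  beta (monomial s) = j ^+ (\sum_(x <- s) weight_b x) * monomial s.
Proof.
elim: s => [|x s IHs] ws; first by rewrite /monomial !big_nil rmorph1 mulr1.
have [[_ _ bx] /IHs bs] /= := weights_cons ws; case/andP=> x_even /bs {}bs.
rewrite (negbTE x_even) in bx.
by rewrite monomial_cons rmorphM bx bs big_cons exprD mulrACA.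
Qed.

(** Invariance under the abelian subgroup of index 2 generated by a and b^2. *)
Definition index2_invariant u := alpha u = u /\ beta (beta u) = u.

Definition zero_sum (s : seq factor) : bool :=
  (4 %| \sum_(x <- s) weight_a x)%N && (2 %| \sum_(x <- s) weight_b x)%N.

Lemma index2_invariant_monomial s : weights s -> zero_sum s ->
  index2_invariant (monomial s).
Proof.
move=> ws /andP[a0 b0]; split.
  rewrite alpha_monomial // (@jX_mod _ 0%N) ?mul1r //; exact/eqP.
by rewrite beta2_monomial // -signr_odd -[odd _]negbK -dvdn2 b0 mul1r.
Qed.

Lemma perm_zero_sum s1 s2 : perm_eq s1 s2 -> zero_sum s1 = zero_sum s2.
Proof. by move=> s12; rewrite /zero_sum !(perm_big _ s12). Qed.

Lemma zero_sum_cat s1 s2 : zero_sum s1 -> zero_sum (s1 ++ s2) = zero_sum s2.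
Proof. by case/andP=> a1 b1; rewrite /zero_sum !big_cat /= !dvdn_addr. Qed.

(** The relative transfer from the subgroup of index 2 to the whole group. *)
Definition transfer u := u + beta u.

Lemma H_transfer d u : H d u -> H d (transfer u).
Proof. by move=> Hu; apply/H_add/H_beta. Qed.

Lemma invariant_transfer u : index2_invariant u -> invariant (transfer u).
Proof.
move=> [au bu]; split; rewrite rmorphD /=; last by rewrite bu addrC.
by rewrite -{2}au alpha_beta_alpha au.
Qed.

Lemma index2_invariant_mul u v : index2_invariant u -> index2_invariant v ->
  index2_invariant (u * v).
Proof. by move=> [au bu] [av bv]; split; rewrite !rmorphM /= ?au ?av ?bu ?bv. Qed.

Lemma index2_invariant_beta u : index2_invariant u -> index2_invariant (beta u).
Proof. by move=> [au bu]; split; [rewrite -{1}au alpha_beta_alpha | rewrite bu]. Qed.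

Section InductionStep.

Variable d : nat.
Hypothesis d_ge8 : (8 <= d)%N.
Hypothesis B_smaller : forall e u, (e < d)%N -> H e u -> invariant u -> B u.

Lemma B_transfer e u : (e < d)%N -> H e u -> index2_invariant u -> B (transfer u).
Proof.
move=> e_d Hu Iu; apply: B_smaller e_d _ _; first exact: H_transfer.
exact: invariant_transfer.
Qed.

(** Modulo products of invariants of lower degree, moving one factor by beta
    only changes the sign of the transfer: expand transfer u1 * transfer u2. *)
Lemma B_transfer_flip e1 e2 u1 u2 : H e1 u1 -> H e2 u2 -> index2_invariant u1 ->
  index2_invariant u2 -> (0 < e1)%N -> (0 < e2)%N -> (e1 + e2 = d)%N ->
  B (transfer (beta u1 * u2)) -> B (transfer (u1 * u2)).
Proof.
move=> Hu1 Hu2 A1 A2 e1_gt0 e2_gt0 e12 Bflip.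
have -> : transfer (u1 * u2) = transfer u1 * transfer u2 + - transfer (beta u1 * u2).
  by rewrite /transfer !rmorphM /= A1.2; ring.
apply: B_add; last exact: B_opp.
by apply: B_mul; [apply: B_transfer Hu1 A1 | apply: B_transfer Hu2 A2]; lia.
Qed.

(** With three factors the sign rule of B_transfer_flip can be applied in two
    ways: moving all three factors changes the sign three times, but leaves the
    transfer as it is. *)
Lemma B_transfer_three e1 e2 e3 u1 u2 u3 :
  H e1 u1 -> H e2 u2 -> H e3 u3 ->
  index2_invariant u1 -> index2_invariant u2 -> index2_invariant u3 ->
  (0 < e1)%N -> (0 < e2)%N -> (0 < e3)%N -> (e1 + e2 + e3 = d)%N ->
  B (transfer (u1 * u2 * u3)).
Proof.
move=> H1 H2 H3 A1 A2 A3 e1_gt0 e2_gt0 e3_gt0 e123; apply: B_half.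
have -> : transfer (u1 * u2 * u3) + transfer (u1 * u2 * u3) =
    transfer (u2 * u3) * transfer u1 + transfer (u1 * u3) * transfer u2 +
    - (transfer (u1 * beta u2) * transfer u3).
  by rewrite /transfer !rmorphM /= A2.2; ring.
apply: B_add; last apply: B_opp; first apply: B_add.
- apply: B_mul; first by apply: B_transfer (H_mul H2 H3) (index2_invariant_mul A2 A3); lia.
  by apply: B_transfer H1 A1; lia.
- apply: B_mul; first by apply: B_transfer (H_mul H1 H3) (index2_invariant_mul A1 A3); lia.
  by apply: B_transfer H2 A2; lia.
apply: B_mul; last by apply: B_transfer H3 A3; lia.
have A12 := index2_invariant_mul A1 (index2_invariant_beta A2).
by apply: B_transfer (H_mul H1 (H_beta H2)) A12; lia.
Qed.

(** The pair is invariant under the index 2 subgroup, and the other terms are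
    too many to be a minimal zero-sum sequence: three factors appear. *)
Lemma B_transfer_mixed_pair s : weights s -> size s = d -> zero_sum s ->
  mixed_pair weight_a weight_b s -> B (transfer (monomial s)).
Proof.
move=> ws sd s0 [x [y [r [sE _ a0 b0]]]].
have {}ws := perm_weights sE ws; rewrite (perm_zero_sum sE) in s0.
rewrite (perm_size sE) /= in sd; rewrite (monomial_perm sE).
rewrite -[x :: y :: r]/([:: x; y] ++ r) in ws s0 *.
have [wxy wr] := weights_cat ws.
have xy0 : zero_sum [:: x; y] by rewrite /zero_sum !big_cons !big_nil !addn0 a0.
rewrite zero_sum_cat // in s0.
(* The rest has length at least 6, so the second part s2 below is not empty. *)
have [|s1 [s2 [rE s1_gt0 s1_le5 a1 b1]]] := zero_subsum5 weight_a weight_b (s := r).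
  by rewrite -2!ltnS sd ltnW.
have s10 : zero_sum s1 by rewrite /zero_sum a1.
have [ws1 ws2] := weights_cat (perm_weights rE wr).
rewrite (perm_zero_sum rE) zero_sum_cat // in s0.
have := perm_size rE; rewrite size_cat => r_size.
rewrite /= in s1_gt0 s1_le5 r_size.
rewrite monomial_cat (monomial_perm rE) monomial_cat mulrA.
by apply: (B_transfer_three (H_monomial wxy) (H_monomial ws1) (H_monomial ws2));
  do ?exact: index2_invariant_monomial; rewrite //=; lia.
Qed.

(** The action of beta on factors; the first exponent is negated modulo 4, which
    changes nothing when it is even. *)
Definition flip (x : factor) : factor := ((3 * weight_a x)%N, weight_b x, beta x.2).

Lemma weight_vector_flip x : weight_vector x -> weight_vector (flip x).
Proof.
case=> Hx ax bx; split; rewrite /flip /weight_a /weight_b /=; first exact: H_beta.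
  exact: alpha_beta_eigen.
rewrite oddM /=; case: ifP bx => _ bx; rewrite bx.
  by rewrite rmorphM rmorphXn rmorphN rmorph1.
by rewrite rmorphM rmorphXn /= beta_j bx.
Qed.

Lemma weights_flip s : weights s -> weights (map flip s).
Proof. by move=> ws _ /mapP[x /ws xs ->]; apply: weight_vector_flip. Qed.

Lemma monomial_flip s : monomial (map flip s) = beta (monomial s).
Proof. by rewrite /monomial big_map rmorph_prod. Qed.

Lemma zero_sum_flip s : zero_sum s -> zero_sum (map flip s).
Proof.
rewrite /zero_sum !big_map /flip /weight_a /weight_b /= -big_distrr /=.
by case/andP=> a0 ->; rewrite dvdn_mull.
Qed.

(** Moving the first part by beta turns the common odd weight into a mixed
    pair. *)
Lemma B_transfer_split_class s : weights s -> size s = d -> zero_sum s ->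
  split_class weight_a weight_b s -> B (transfer (monomial s)).
Proof.
move=> ws sd s0 [x [y [s1 [s2 [sE /and3P[ox axy bxy] a1 b1]]]]].
rewrite (monomial_perm sE) monomial_cat.
have [ws1 ws2] := weights_cat (perm_weights sE ws).
have s10 : zero_sum (x :: s1) by rewrite /zero_sum a1.
rewrite (perm_zero_sum sE) zero_sum_cat // in s0.
rewrite (perm_size sE) size_cat in sd.
apply: (B_transfer_flip (H_monomial ws1) (H_monomial ws2)) => //;
  try exact: index2_invariant_monomial.
rewrite -monomial_flip -monomial_cat; apply: B_transfer_mixed_pair.
- have wf := weights_flip ws1.
  by move=> z; rewrite mem_cat => /orP[/wf|/ws2].
- by rewrite size_cat size_map.
- by rewrite zero_sum_cat // zero_sum_flip.
rewrite /weight_a /weight_b in ox axy bxy; exists (flip x), y, (map flip s1 ++ s2).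
rewrite /flip /weight_a /weight_b /=; split.
- by rewrite perm_cons perm_sym -cat1s perm_catCA.
- by rewrite oddM ox; move: ox axy; clear; lia.
- by move: axy; clear; lia.
by move: bxy; clear; lia.
Qed.

(** A factor invariant under the whole group can be taken out of the
    transfer. *)
Lemma B_transfer_even_factor s : weights s -> size s = d -> zero_sum s ->
  even_factor weight_a weight_b s -> B (transfer (monomial s)).
Proof.
move=> ws sd s0 [s1 [s2 [sE s1_gt0 s2_gt0 s1_even /andP[a1 b1]]]].
rewrite (monomial_perm sE) monomial_cat.
have [ws1 ws2] := weights_cat (perm_weights sE ws).
have s10 : zero_sum s1 by rewrite /zero_sum a1; apply: dvdn_trans b1.
rewrite (perm_zero_sum sE) zero_sum_cat // in s0.
rewrite (perm_size sE) size_cat in sd.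
have beta_s1 : beta (monomial s1) = monomial s1.
  rewrite beta_monomial_even // (@jX_mod _ 0%N) ?mul1r //; exact/eqP.
have -> : transfer (monomial s1 * monomial s2) = monomial s1 * transfer (monomial s2).
  by rewrite /transfer rmorphM /= beta_s1 mulrDr.
apply: B_mul; last first.
  apply: B_transfer (H_monomial ws2) (index2_invariant_monomial ws2 s0).
  by rewrite -sd -[X in (X < _)%N]add0n ltn_add2r.
apply: B_smaller (H_monomial ws1) _.
  by rewrite -sd -[X in (X < _)%N]addn0 ltn_add2l.
by split=> //; have [] := index2_invariant_monomial ws1 s10.
Qed.

Lemma B_transfer_monomial s : weights s -> size s = d -> zero_sum s ->
  B (transfer (monomial s)).
Proof.
move=> ws sd s0; have /andP[a0 b0] := s0.
have [|mix|split|even] := long_zero_sum_factors _ a0 b0; first by rewrite sd.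
- exact: B_transfer_mixed_pair.
- exact: B_transfer_split_class.
- exact: B_transfer_even_factor.
Qed.

(** Sixteen times the Reynolds operator, arranged along the subgroup chain. *)
Definition reynolds u :=
  let v := u + alpha u + alpha (alpha u) + alpha (alpha (alpha u)) in
  transfer (v + beta (beta v)).

Lemma reynolds_add u v : reynolds (u + v) = reynolds u + reynolds v.
Proof. by rewrite /reynolds /transfer !rmorphD /=; ring. Qed.

Lemma reynolds0 : reynolds 0 = 0.
Proof. by rewrite /reynolds /transfer !(rmorph0, addr0). Qed.

Lemma B_mulrn u n : B u -> B (u *+ n).
Proof.
move=> Bu; elim: n => [|n IHn]; first exact: B_0.
by rewrite mulrS; apply: B_add.
Qed.

(** Averaging over the subgroup of index 2 kills a product of weight vectors
    whose weight is not zero, and multiplies it by 8 otherwise. *)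
Lemma B_reynolds_monomial s : weights s -> size s = d ->
  B (reynolds (monomial s)).
Proof.
move=> ws sd; rewrite /reynolds; set u := monomial s.
have alpha_u := alpha_monomial ws; set a := (\sum_(x <- s) weight_a x)%N in alpha_u.
have beta_u := beta2_monomial ws; set b := (\sum_(x <- s) weight_b x)%N in beta_u.
rewrite -/u in alpha_u beta_u.
have -> : u + alpha u + alpha (alpha u) + alpha (alpha (alpha u)) =
    (1 + j ^+ a + j ^+ a * j ^+ a + j ^+ a * (j ^+ a * j ^+ a)) * u.
  by rewrite !(alpha_u, rmorphM, rmorphXn) /= !alpha_j; ring.
have -> : 1 + j ^+ a + j ^+ a * j ^+ a + j ^+ a * (j ^+ a * j ^+ a) =
    if (4 %| a)%N then 4%:R else 0.
  have -> : j ^+ a = j ^+ (a %% 4) by apply: jX_mod; rewrite modn_mod.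
  rewrite /dvdn; case: (a %% 4)%N (ltn_pmod a (isT : (0 < 4)%N)) => [|[|[|[|//]]]] _ /=.
  - by ring.
  - by rewrite expr1 jj; ring.
  - by rewrite expr2 jj; ring.
  by rewrite exprS expr2 jj; rewrite mulrN1 mulrNN jj; ring.
case: ifP => [a0|_]; last by rewrite /transfer !(mul0r, rmorph0, addr0); apply: B_0.
rewrite mulr_natl !raddfMn /= beta_u -mulrnDl.
have [b_odd|b_even] := boolP (odd b).
  by rewrite -signr_odd b_odd mulN1r subrr mul0rn /transfer rmorph0 addr0; apply: B_0.
rewrite -signr_odd (negbTE b_even) mul1r /transfer raddfMn /= -mulrnDl rmorphD /=.
have -> : u + u + (beta u + beta u) = transfer u *+ 2 by rewrite /transfer mulr2n addrACA.
do 2!apply: B_mulrn; apply: B_transfer_monomial => //.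
by rewrite /zero_sum a0 dvdn2.
Qed.

(** The factors in l are expanded into weight vectors one at a time, and moved
    to s. *)
Lemma B_reynolds_prod s (l : seq T) : weights s -> {in l, forall u, H 1 u} ->
  (size s + size l = d)%N -> B (reynolds (monomial s * \prod_(u <- l) u)).
Proof.
elim: l s => [|u l IHl] s ws Hl sd.
  by rewrite big_nil mulr1; apply: B_reynolds_monomial => //; rewrite -sd addn0.
have [|xs [wxs ->]] := @weight_decomposition u; first by apply: Hl; rewrite mem_head.
have {}Hl : {in l, forall v, H 1 v} by move=> v vl; apply: Hl; rewrite in_cons vl orbT.
rewrite big_cons mulr_suml mulr_sumr.
elim: xs wxs => [|x xs IHxs] wxs; first by rewrite big_nil reynolds0; apply: B_0.
have [wx {}wxs] := weights_cons wxs.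
rewrite big_cons reynolds_add; apply: B_add; last exact: IHxs.
rewrite mulrA [_ * x.2]mulrC -monomial_cons; apply: IHl => //.
  by move=> y; rewrite in_cons => /orP[/eqP->|/ws].
by move: sd => /=; rewrite addnS.
Qed.

Lemma B_degree u : H d u -> invariant u -> B u.
Proof.
move=> Hu [au bu].
have : B (reynolds u).
  have dE : d = d.-1.+1 by rewrite prednK //; apply: leq_trans d_ge8.
  rewrite dE in Hu; move: u Hu {au bu}; apply: H_span.
  - by rewrite reynolds0; apply: B_0.
  - by move=> u v; rewrite reynolds_add; apply: B_add.
  move=> l l_size Hl.
  have -> : \prod_(u <- l) u = monomial [::] * \prod_(u <- l) u.
    by rewrite /monomial big_nil mul1r.
  by apply: (@B_reynolds_prod [::]) => //; rewrite l_size -dE.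
rewrite /reynolds /transfer !(au, rmorphD, bu) /=.
have -> : u + u + u + u = (u + u) + (u + u) by rewrite addrA.
by do 4!move/B_half.
Qed.

End InductionStep.

Theorem generated_in_degree7 d u : H d u -> invariant u -> B u.
Proof.
elim/ltn_ind: d u => d IHd u; have [d_le7|d_gt7] := leqP d 7; first exact: B_low.
by apply: B_degree => // e v /IHd; apply.
Qed.

End DegreeSeven.

(** * Adjoining a square root of -1 *)

(** S[i] with i^2 = -1, as pairs of coordinates over S. It is not a field when S
    is a field containing a square root of -1, but only the invertibility of 2
    matters, and this construction treats all fields alike. *)
Definition gauss (S : Type) : Type := (S * S)%type.

Section GaussRing.
Variable S : comNzRingType.

HB.instance Definition _ := GRing.Zmodule.copy (gauss S) (S * S)%type.

Definition gauss_one : gauss S := (1, 0).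
Definition gauss_mul (u v : gauss S) : gauss S :=
  (u.1 * v.1 - u.2 * v.2, u.1 * v.2 + u.2 * v.1).

Lemma gauss_mulA : associative gauss_mul.
Proof. by move=> u v w; congr pair; rewrite /=; ring. Qed.
Lemma gauss_mulC : commutative gauss_mul.
Proof. by move=> u v; congr pair; rewrite /=; ring. Qed.
Lemma gauss_mul1 : left_id gauss_one gauss_mul.
Proof. by case=> x y; congr pair; rewrite /=; ring. Qed.
Lemma gauss_mulDl : left_distributive gauss_mul +%R.
Proof. by case=> [x y] [z t] [a b]; congr pair; rewrite /=; ring. Qed.
Lemma gauss_one_neq0 : gauss_one != 0.
Proof. by rewrite xpair_eqE oner_eq0. Qed.

HB.instance Definition _ := GRing.Zmodule_isComNzRing.Build (gauss S)
  gauss_mulA gauss_mulC gauss_mul1 gauss_mulDl gauss_one_neq0.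

Definition gauss_i : gauss S := (0, 1).
Definition gauss_re (x : S) : gauss S := (x, 0).

Lemma gaussM (u v : gauss S) :
  u * v = (u.1 * v.1 - u.2 * v.2, u.1 * v.2 + u.2 * v.1).
Proof. by []. Qed.

Lemma gaussD (u v : gauss S) : u + v = (u.1 + v.1, u.2 + v.2).
Proof. by []. Qed.

Lemma gauss_ii : gauss_i * gauss_i = -1.
Proof. by rewrite gaussM /= -[-1]/(- (1 : S), - (0 : S)); congr pair; ring. Qed.

Lemma gauss_re_is_additive : nmod_morphism gauss_re.
Proof. by split=> // x y; rewrite gaussD /= addr0. Qed.

Lemma gauss_re_is_multiplicative : monoid_morphism gauss_re.
Proof. by split=> // x y; rewrite gaussM /=; congr pair; ring. Qed.

HB.instance Definition _ :=
  GRing.isNmodMorphism.Build S (gauss S) gauss_re gauss_re_is_additive.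
HB.instance Definition _ :=
  GRing.isMonoidMorphism.Build S (gauss S) gauss_re gauss_re_is_multiplicative.

Lemma gaussE (u : gauss S) : u = gauss_re u.1 + gauss_i * gauss_re u.2.
Proof. by case: u => x y; rewrite gaussM gaussD /=; congr pair; ring. Qed.

End GaussRing.

Arguments gauss_i {S}.

Section GaussMap.
Variables (S S' : comNzRingType) (f : {rmorphism S -> S'}).

Definition gauss_map (u : gauss S) : gauss S' := (f u.1, f u.2).

Lemma gauss_map_is_additive : nmod_morphism gauss_map.
Proof. by split=> [|u v]; rewrite /gauss_map ?rmorph0 // !rmorphD. Qed.

Lemma gauss_map_is_multiplicative : monoid_morphism gauss_map.
Proof.
split=> [|u v]; first by rewrite /gauss_map rmorph1 rmorph0.
by rewrite /gauss_map gaussM !(rmorphD, rmorphN, rmorphM).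
Qed.

HB.instance Definition _ :=
  GRing.isNmodMorphism.Build (gauss S) (gauss S') gauss_map gauss_map_is_additive.
HB.instance Definition _ := GRing.isMonoidMorphism.Build (gauss S) (gauss S')
  gauss_map gauss_map_is_multiplicative.

Lemma gauss_map_i : gauss_map gauss_i = gauss_i.
Proof. by rewrite /gauss_map rmorph0 rmorph1. Qed.

End GaussMap.

(** * The action on the symmetric algebra *)

Lemma mpoly_morph_ext n (R S : comNzRingType)
    (f f' : {rmorphism {mpoly R[n]} -> S}) :
  (forall c, f c%:MP = f' c%:MP) -> (forall i, f 'X_i = f' 'X_i) -> f =1 f'.
Proof.
move=> fC fX p; rewrite (mpolyE p) !rmorph_sum; apply: eq_bigr => m _.
rewrite /= -mul_mpolyC !rmorphM fC mpolyXE_id !rmorph_prod; congr (_ * _).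
by apply: eq_bigr => i _; rewrite /= !rmorphXn /= fX.
Qed.

Section SymmetricAlgebra.

Variables (F : fieldType) (gT : finGroupType) (G : {group gT}).
Variables (n : nat) (rG : mx_representation F G n).

HB.instance Definition _ (g : gT) := GRing.RMorphism.copy (sym_act rG g)
  (comp_mpoly [tuple \sum_(i < n) rG g i j *: 'X_i | j < n]).

Lemma sym_actXi g i : sym_act rG g 'X_i = \sum_(k < n) rG g k i *: 'X_k.
Proof. by rewrite /sym_act comp_mpolyXU -tnth_nth tnth_mktuple. Qed.

Lemma sym_actZ g c p : sym_act rG g (c *: p) = c *: sym_act rG g p.
Proof. exact: comp_mpolyZ. Qed.

Lemma sym_actX g m : sym_act rG g 'X_[m] = \prod_(i < n) sym_act rG g 'X_i ^+ m i.
Proof. by rewrite mpolyXE_id rmorph_prod; apply: eq_bigr => i _; rewrite rmorphXn. Qed.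

Lemma sym_actC g c : sym_act rG g c%:MP = c%:MP.
Proof. exact: comp_mpolyC. Qed.

Lemma sym_act_mul g h p : g \in G -> h \in G ->
  sym_act rG (g * h)%g p = sym_act rG g (sym_act rG h p).
Proof.
move=> Gg Gh; rewrite -[RHS]/((sym_act rG g \o sym_act rG h) p).
apply: mpoly_morph_ext => [c|i] /=; first by rewrite !sym_actC.
rewrite !sym_actXi rmorph_sum /=.
under [RHS]eq_bigr => k _ do rewrite sym_actZ sym_actXi scaler_sumr.
rewrite exchange_big /=; apply: eq_bigr => k _.
rewrite repr_mxM // mxE scaler_suml; apply: eq_bigr => l _.
by rewrite scalerA mulrC.
Qed.

Lemma sym_act1 p : sym_act rG 1%g p = p.
Proof.
apply: (mpoly_morph_ext (f' := idfun)) => [c|i] /=; first exact: sym_actC.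
rewrite sym_actXi (bigD1 i) //= big1 ?addr0 => [|k ki]; rewrite repr_mx1 mxE.
  by rewrite eqxx scale1r.
by rewrite (negbTE ki) scale0r.
Qed.

Lemma sym_act_expg g k p : g \in G ->
  sym_act rG (g ^+ k)%g p = iter k (sym_act rG g) p.
Proof.
move=> Gg; elim: k => [|k IHk]; first by rewrite expg0 sym_act1.
by rewrite expgS sym_act_mul ?groupX // IHk.
Qed.

Lemma dhomog_prod_exp (f : 'I_n -> {mpoly F[n]}) (m : 'X_{1..n}) :
  (forall i, f i \is 1.-homog) -> \prod_(i < n) f i ^+ m i \is (mdeg m).-homog.
Proof.
move=> f1; rewrite mdegE; elim/big_ind2: _ => [|p d q e|i _].
- exact: dhomog1.
- exact: dhomogM.
- by rewrite -{2}[m i]mul1n; apply: dhomogMn.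
Qed.

Lemma sym_act_homog g d p : p \is d.-homog -> sym_act rG g p \is d.-homog.
Proof.
move=> /dhomogP p_d; rewrite (mpolyE p) rmorph_sum /= big_seq.
apply: rpred_sum => m /p_d <-; rewrite sym_actZ; apply: rpredZ.
rewrite sym_actX; apply: dhomog_prod_exp => i; rewrite sym_actXi.
by apply: rpred_sum => k _; apply: rpredZ; rewrite dhomogX /= mdeg1.
Qed.

Lemma mpolyX_seq d (m : 'X_{1..n}) : mdeg m = d ->
  exists s : seq 'I_n, size s = d /\ 'X_[m] = \prod_(i <- s) 'X_i :> {mpoly F[n]}.
Proof.
elim: d m => [|d IHd] m md.
  exists [::]; rewrite big_nil; split=> //; move/eqP: md.
  by rewrite mdeg_eq0 => /eqP->; rewrite mpolyX0.
have /existsP[i mi] : [exists i, m i != 0%N].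
  apply: contra_eqT md; rewrite negb_exists => /forallP m0.
  by rewrite mdegE big1 // => i _; apply/eqP; rewrite -[_ == _]negbK.
have mE : ((m - U_(i)) + U_(i))%MM = m.
  apply: submK; apply/mnm_lepP => k; rewrite mnm1E.
  by case: eqP => [<-|_ //]; rewrite lt0n.
have [|s [sd ms]] := IHd (m - U_(i))%MM.
  by apply/eqP; rewrite -eqSS -md -{2}mE mdegD mdeg1 addn1.
by exists (i :: s); rewrite /= sd -mE mpolyXD ms big_cons mulrC.
Qed.

End SymmetricAlgebra.

(** * The upper bound *)

Section Upper.
Variables (F : fieldType) (gT : finGroupType) (G : {group gT}).
Variables (n : nat) (rG : mx_representation F G n).

Lemma sym_act_pihomog g d p :
  sym_act rG g (pihomog mdeg d p) = pihomog mdeg d (sym_act rG g p).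
Proof.
have -> : sym_act rG g p = \sum_(m <- msupp p) sym_act rG g (p@_m *: 'X_[m]).
  by rewrite {1}(mpolyE p) rmorph_sum.
rewrite [in RHS]raddf_sum pihomogE rmorph_sum big_mkcond /=.
apply: eq_bigr => m _; rewrite sym_actZ linearZ /=.
have mX : sym_act rG g 'X_[m] \is (mdeg m).-homog.
  by apply: sym_act_homog; rewrite dhomogX.
case: eqP => [md | /eqP md]; first by rewrite pihomog_dE // -md.
by rewrite (pihomog_ne0 md mX) scaler0.
Qed.

Definition homogeneous_gauss d (u : gauss {mpoly F[n]}) : Prop :=
  u.1 \is d.-homog /\ u.2 \is d.-homog.

Lemma homogeneous_re d p : p \is d.-homog -> homogeneous_gauss d (gauss_re p).
Proof. by split=> //=; apply: dhomog0. Qed.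

Lemma homogeneous_add d u v :
  homogeneous_gauss d u -> homogeneous_gauss d v -> homogeneous_gauss d (u + v).
Proof. by move=> [u1 u2] [v1 v2]; split; apply: rpredD. Qed.

Lemma homogeneous_mul d e u v : homogeneous_gauss d u ->
  homogeneous_gauss e v -> homogeneous_gauss (d + e) (u * v).
Proof.
move=> [u1 u2] [v1 v2]; rewrite gaussM.
by split; [apply: rpredB | apply: rpredD]; apply: dhomogM.
Qed.

Lemma homogeneous_i d u :
  homogeneous_gauss d u -> homogeneous_gauss d (gauss_i * u).
Proof.
move=> Hu; rewrite -[d]add0n; apply: homogeneous_mul Hu.
by split; [exact: dhomog0 | exact: dhomog1].
Qed.

(** Scalars, including i, are absorbed in the first linear factor. *)
Lemma homogeneous_span d (P : gauss {mpoly F[n]} -> Prop) : P 0 ->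
  (forall u v, P u -> P v -> P (u + v)) ->
  (forall s, size s = d.+1 -> {in s, forall l, homogeneous_gauss 1 l} ->
     P (\prod_(l <- s) l)) ->
  forall u, homogeneous_gauss d.+1 u -> P u.
Proof.
move=> P0 Padd Pprod u [u1 u2].
have Pz z p : (forall v, homogeneous_gauss 1 v -> homogeneous_gauss 1 (z * v)) ->
    p \is d.+1.-homog -> P (z * gauss_re p).
  move=> zH /dhomogP pd; rewrite (mpolyE p) rmorph_sum mulr_sumr big_seq.
  elim/big_ind: _ => // m /pd /= /(@mpolyX_seq F) [[|k s] [//= [sd] ->]].
  have XH c i : homogeneous_gauss 1 (gauss_re (c *: 'X_i : {mpoly F[n]})).
    by apply/homogeneous_re/rpredZ; rewrite dhomogX /= mdeg1.
  pose l := z * gauss_re (p@_m *: 'X_k) :: [seq gauss_re 'X_i | i <- s].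
  have -> : z * gauss_re (p@_m *: \prod_(i <- k :: s) 'X_i) = \prod_(v <- l) v.
    by rewrite !big_cons big_map scalerAl rmorphM rmorph_prod mulrA.
  apply: Pprod; first by rewrite /= size_map sd.
  move=> v; rewrite in_cons => /orP[/eqP->|/mapP[i _ ->]]; first exact/zH/XH.
  by rewrite -['X_i]scale1r; apply: XH.
rewrite (gaussE u); apply: Padd; last by apply: Pz u2 => v; apply: homogeneous_i.
by rewrite -[gauss_re _]mul1r; apply: Pz u1 => v; rewrite mul1r.
Qed.

(** Both coordinates lie in the subalgebra generated over the base field. This
    is a subalgebra over F[i], and for an element of the base algebra
    it means membership in the original subalgebra: no descent is left to do. *)
Definition gauss_subalg (S : {mpoly F[n]} -> Prop) (u : gauss {mpoly F[n]}) :=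
  gen_subalg S u.1 /\ gen_subalg S u.2.

Lemma gen_subalgZ (A : algType F) (S : A -> Prop) c x :
  gen_subalg S x -> gen_subalg S (c *: x).
Proof.
move=> Sx; rewrite -[x]mul1r scalerAl.
by apply: gen_subalg_mul Sx; apply: gen_subalg_scalar.
Qed.

Lemma gen_subalg0 (A : algType F) (S : A -> Prop) : gen_subalg S 0.
Proof. by rewrite -(scale0r (1 : A)); apply: gen_subalg_scalar. Qed.

Lemma gauss_subalg_mul S u v :
  gauss_subalg S u -> gauss_subalg S v -> gauss_subalg S (u * v).
Proof.
move=> [u1 u2] [v1 v2]; rewrite gaussM; split => /=.
  by apply/gen_subalg_add; rewrite -?scaleN1r; [|apply/gen_subalgZ];
    apply: gen_subalg_mul.
by apply/gen_subalg_add; apply: gen_subalg_mul.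
Qed.

Variables a b : gT.
Hypothesis G_gen : (<[a]> <*> <[b]> = G)%g.
Hypotheses (a4 : (a ^+ 4 = 1)%g) (b4 : (b ^+ 4 = 1)%g).
Hypothesis ab_rel : (b * a * b^-1 = a^-1)%g.
Hypothesis two_neq0 : 2%:R != 0 :> F.

Lemma gen_in_group : a \in G /\ b \in G.
Proof. by rewrite -G_gen; split; rewrite mem_gen // inE cycle_id ?orbT. Qed.

Lemma sym_invariant_generators p :
  sym_act rG a p = p -> sym_act rG b p = p -> sym_invariant rG p.
Proof.
move=> pa pb; have [Ga Gb] := gen_in_group.
have stab_group : group_set [set g in G | sym_act rG g p == p].
  apply/group_setP; split=> [|g h]; first by rewrite inE group1 sym_act1 eqxx.
  rewrite !inE => /andP[Gg /eqP pg] /andP[Gh /eqP ph].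
  by rewrite groupM // sym_act_mul // ph pg eqxx.
have : (<[a]> <*> <[b]> \subset Group stab_group)%g.
  by rewrite join_subG !cycle_subG !inE Ga Gb pa pb !eqxx.
by rewrite G_gen => /subsetP sub g /sub; rewrite inE => /andP[_ /eqP].
Qed.

Lemma homogeneous_invariant_generated d p : p \is d.-homog ->
  sym_invariant rG p -> gen_subalg (low_degree_invariant rG 7) p.
Proof.
move=> p_d p_inv; have [Ga Gb] := gen_in_group.
pose low := gen_subalg (low_degree_invariant rG 7).
pose h : gauss {mpoly F[n]} := gauss_re (2%:R^-1)%:MP.
have act4 g q : g \in G -> (g ^+ 4 = 1)%g ->
    sym_act rG g (sym_act rG g (sym_act rG g (sym_act rG g q))) = q.
  by move=> Gg g4; have := sym_act_expg rG 4 q Gg; rewrite g4 sym_act1.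
have half_half : 2%:R^-1 + 2%:R^-1 = 1 :> F
  by rewrite -mulr2n -[_^-1 *+ 2]mulr_natl mulfV.
suff [] : gauss_subalg (low_degree_invariant rG 7) (gauss_re p) by [].
apply: (@generated_in_degree7 _ gauss_i h (gauss_map (sym_act rG a))
  (gauss_map (sym_act rG b)) homogeneous_gauss
  (gauss_subalg (low_degree_invariant rG 7)) _ _ _ _ _ _ _ _ _ _ _ _ _ _ _ _ _ _ _ _
  d (gauss_re p) (homogeneous_re p_d)).
- exact: gauss_ii.
- by rewrite -rmorphD /= -mpolyCD half_half.
- exact: gauss_map_i.
- exact: gauss_map_i.
- by case=> x y; congr pair; apply: act4.
- by case=> x y; congr pair; apply: act4.
- have aba : (a * (b * a) = b)%g by rewrite -[(b * a)%g](mulgKV b) ab_rel mulKVg.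
  have act_aba q : sym_act rG a (sym_act rG b (sym_act rG a q)) = sym_act rG b q.
    by rewrite -(sym_act_mul rG q Gb Ga) -(sym_act_mul rG q Ga (groupM Gb Ga)) aba.
  by case=> x y; congr pair; exact: act_aba.
- by split; [exact: dhomog1 | exact: dhomog0].
- exact: homogeneous_add.
- exact: homogeneous_mul.
- exact: homogeneous_i.
- move=> e u Hu; rewrite -[e]add0n; apply: homogeneous_mul Hu.
  apply: homogeneous_re; rewrite -[X in X%:MP]mulr1 mpolyCM mul_mpolyC.
  exact/rpredZ/dhomog1.
- by move=> e u [u1 u2]; split; apply: sym_act_homog.
- by move=> e u [u1 u2]; split; apply: sym_act_homog.
- exact: homogeneous_span.
- by move=> u v [u1 u2] [v1 v2]; split; apply: gen_subalg_add.
- exact: gauss_subalg_mul.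
- split; first exact: gen_subalg0.
  by rewrite /= -(scale1r 1); apply: gen_subalg_scalar.
- split; last exact: gen_subalg0.
  by rewrite /= -alg_mpolyC; apply: gen_subalg_scalar.
- move=> e [u1 u2] e7 [/= Hu1 Hu2] [[au1 au2] [bu1 bu2]].
  by split=> /=; apply: gen_subalg_in; split; (try by exists e);
    apply: sym_invariant_generators.
by split; congr pair; [exact: p_inv | exact: rmorph0 | exact: p_inv | exact: rmorph0].
Qed.

Theorem invariants_generated_upto7 : invariants_generated_upto rG 7.
Proof.
move=> p p_inv; rewrite (pihomog_partitionE (leqnn (mmeasure mdeg p))).
elim/big_ind: _ => [|q r|d _]; [exact: gen_subalg0 | exact: gen_subalg_add |].
apply: (@homogeneous_invariant_generated d); first exact: pihomogP.
by move=> g Gg; rewrite sym_act_pihomog p_inv.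
Qed.

End Upper.

(** * A model of the group *)

(** The pair (r, s) stands for a^r b^s. *)
Definition c4c4 : Type := ('Z_4 * 'Z_4)%type.

HB.instance Definition _ := Finite.copy c4c4 ('Z_4 * 'Z_4)%type.

Definition c4c4_sgn (s r : 'Z_4) : 'Z_4 := if odd s then - r else r.

Definition c4c4_mul (u v : c4c4) : c4c4 := (u.1 + c4c4_sgn u.2 v.1, u.2 + v.2).

Definition c4c4_inv (u : c4c4) : c4c4 := (- c4c4_sgn u.2 u.1, - u.2).

Lemma odd_Z4D (s s' : 'Z_4) : odd (s + s')%R = odd s (+) odd s'.
Proof. by rewrite -oddD /= odd_mod. Qed.

Lemma odd_Z4N (s : 'Z_4) : odd (- s)%R = odd s.
Proof. by case: s => [[|[|[|[|?]]]] ?]. Qed.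

Lemma c4c4_mulA : associative c4c4_mul.
Proof.
move=> u v w; rewrite /c4c4_mul /c4c4_sgn /= odd_Z4D !addrA; congr pair.
by case: (odd u.2); case: (odd v.2); rewrite /= ?opprD ?opprK addrA.
Qed.

Lemma c4c4_mul1 : left_id ((0, 0) : c4c4) c4c4_mul.
Proof. by case=> r s; rewrite /c4c4_mul /= !add0r. Qed.

Lemma c4c4_mulr1 : right_id ((0, 0) : c4c4) c4c4_mul.
Proof.
by case=> r s; rewrite /c4c4_mul /c4c4_sgn /= oppr0; case: ifP; rewrite !addr0.
Qed.

Lemma c4c4_mulV : left_inverse ((0, 0) : c4c4) c4c4_inv c4c4_mul.
Proof.
by case=> r s; rewrite /c4c4_mul /c4c4_inv /c4c4_sgn /= odd_Z4N !addNr.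
Qed.

Lemma c4c4_mulrV : right_inverse ((0, 0) : c4c4) c4c4_inv c4c4_mul.
Proof.
case=> r s; rewrite /c4c4_mul /c4c4_inv /c4c4_sgn /= subrr.
by case: (odd s); rewrite ?opprK subrr.
Qed.

HB.instance Definition _ := isGroup.Build c4c4
  c4c4_mulA c4c4_mul1 c4c4_mulr1 c4c4_mulV c4c4_mulrV.

Definition c4c4_a : c4c4 := (1, 0).
Definition c4c4_b : c4c4 := (0, 1).

Lemma c4c4M (u v : c4c4) : (u * v)%g = (u.1 + c4c4_sgn u.2 v.1, u.2 + v.2).
Proof. by []. Qed.

Lemma c4c4_homGrp :
  (<[c4c4_a]> <*> <[c4c4_b]> \homg
    Grp (a : b : a ^+ 4, b ^+ 4, b * a * b^-1 = a^-1))%g.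
Proof.
apply/existsP; exists (c4c4_a, c4c4_b); rewrite /= !xpair_eqE eqxx /=.
by [].
Qed.

(** * Coefficients of bivariate polynomials *)

(** Since 2 is invertible, so is 1 - j^r. *)
Lemma gauss_fix0 (A : comNzRingType) (j h x : A) r : j * j = -1 -> h + h = 1 ->
  (0 < r < 4)%N -> j ^+ r * x = x -> x = 0.
Proof.
move=> jj hh r4 jx; suff xN : - x = x.
  by rewrite -[x]mul1r -hh mulrDl -{1}xN mulrN addNr.
case: r r4 jx => [|[|[|[|//]]]] //= _ jx.
- by rewrite -mulN1r -jj -mulrA -{2}[j]expr1 jx -[X in X * _]expr1 jx.
- by rewrite -mulN1r -jj -expr2 jx.
have j3 : j ^+ 3 = - j by rewrite exprS expr2 jj mulrN1.
rewrite j3 in jx; rewrite -{2}jx -{2}jx !mulNr mulrN opprK mulrA jj.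
by rewrite mulN1r.
Qed.

Lemma coef_comp_scaleX (A : comNzRingType) (c : A) (P : {poly A}) r :
  (P \Po (c *: 'X))`_r = c ^+ r * P`_r.
Proof.
rewrite comp_polyE coef_sum -[P in RHS]coefK coef_poly.
have cXr i : (P`_i *: (c *: 'X) ^+ i)`_r = if i == r then c ^+ r * P`_r else 0.
  rewrite exprZn !coefZ coefXn [i == r]eq_sym; case: eqP => [->|_].
    by rewrite mulr1 mulrC.
  by rewrite !mulr0.
case: ltnP => r_P.
  rewrite (bigD1 (Ordinal r_P)) //= big1 => [|i ir]; first by rewrite cXr eqxx addr0.
  rewrite cXr -val_eqE /= in ir *; by rewrite (negbTE ir).
rewrite mulr0 big1 // => i _; rewrite cXr; case: eqP => // ir.
by move: (ltn_ord i); rewrite ir ltnNge r_P.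
Qed.

Lemma coef_linear_pow (A : comNzRingType) (c d : A) n r : (n <= r)%N ->
  ((c%:P * 'X + d%:P) ^+ n)`_r = if r == n then c ^+ n else 0.
Proof.
elim: n r => [|n IHn] r nr; first by rewrite !expr0 coef1; case: eqP.
case: r nr => // r nr; rewrite [in LHS]exprS mulrDl coefD -mulrA !coefCM coefXM eqSS.
rewrite !IHn // 1?ltnW // (gtn_eqF nr) mulr0 addr0.
rewrite /=; case: eqP => _; rewrite ?mulr0 -?exprS //.
Qed.

Lemma coefM_ends (A : nzRingType) (P Q : {poly A}) n :
  (forall r, (0 < r < n.+1)%N -> P`_r = 0) ->
  (P * Q)`_n.+1 = P`_0 * Q`_n.+1 + P`_n.+1 * Q`_0.
Proof.
move=> P0; rewrite coefM big_ord_recl big_ord_recr /= subn0 subnn big1 ?add0r //.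
by move=> i _; rewrite P0 ?mul0r //= ltnS ltn_ord.
Qed.

Section Bivariate.
Variable A : comNzRingType.
Implicit Types P Q : {poly {poly A}}.

(** The vanishing conditions leave only the trivial ways to write the monomial
    z^4 t^3 as a product of a monomial of P and one of Q. *)
Lemma coef43M P Q : (forall r, (0 < r < 4)%N -> P`_r = 0) ->
  (forall r, (0 < r < 4)%N -> P`_0`_r = 0) ->
  (forall r, (0 < r < 4)%N -> Q`_0`_r = 0) ->
  (P * Q)`_4`_3 = P`_0`_0 * Q`_4`_3 + P`_4`_3 * Q`_0`_0.
Proof.
move=> P0 Pt0 Qt0; rewrite (coefM_ends _ (n := 3)) // coefD.
rewrite (coefM_ends _ (n := 2)) => [|r /andP[r0 r3]]; last first.
  by apply: Pt0; rewrite r0 (leq_trans r3).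
rewrite [P`_4 * _]mulrC (coefM_ends _ (n := 2)) => [|r /andP[r0 r3]]; last first.
  by apply: Qt0; rewrite r0 (leq_trans r3).
by rewrite (Pt0 3%N isT) (Qt0 3%N isT) !mul0r !addr0 [Q`_0`_0 * _]mulrC.
Qed.

Definition degree_le d P := forall r s, (d < r + s)%N -> P`_r`_s = 0.

Lemma degree_leM d e P Q :
  degree_le d P -> degree_le e Q -> degree_le (d + e) (P * Q).
Proof.
move=> Pd Qe r s rs; rewrite coefM coef_sum big1 // => i _.
rewrite coefM big1 // => l _; have [il|il] := ltnP d (i + l).
  by rewrite Pd ?mul0r.
by rewrite Qe ?mulr0 //; have := ltn_ord i; have := ltn_ord l; lia.
Qed.

Lemma degree_le1 : degree_le 0 1.
Proof. by move=> [|r] [|s] // _; rewrite coef1 //= ?coef1 ?coef0. Qed.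

Lemma degree_leX d P k : degree_le d P -> degree_le (d * k) (P ^+ k).
Proof.
move=> Pd; elim: k => [|k IHk]; first by rewrite muln0; apply: degree_le1.
by rewrite exprS mulnS; apply: degree_leM.
Qed.

Lemma degree_le_linear (c d : A) : degree_le 1 (c%:P%:P * 'X + (d *: 'X)%:P).
Proof.
move=> r s rs; rewrite coefD coefCM coefX coefC coefD.
case: r rs => [|[|r]] rs; rewrite ?mulr0 ?mulr1 ?coef0 ?add0r ?addr0 //.
  by rewrite coefZ coefX; case: s rs => [|[|s]] //= _; rewrite mulr0.
by rewrite coefC; case: s rs.
Qed.

End Bivariate.

(** * The lower bound *)

Section LowerBound.

Variables (F : fieldType) (gT : finGroupType) (G : {group gT}).
Variable f : {morphism G >-> c4c4}.

(** The permutation module with basis the model group, on which G acts by left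
    multiplication through f. *)
Definition perm_rep_mx (g : gT) : 'M[F]_#|{: c4c4}| :=
  \matrix_(i, j) (enum_val i == f g * enum_val j)%g%:R.

Lemma perm_rep_mx_repr : mx_repr G perm_rep_mx.
Proof.
split=> [|g h Gg Gh]; apply/matrixP=> i k; rewrite !mxE.
  by rewrite morph1 mul1g (inj_eq enum_val_inj).
rewrite (bigD1 (enum_rank (f h * enum_val k)%g)) //= big1 => [|l lk].
  by rewrite !mxE enum_rankK eqxx mulr1 addr0 morphM // mulgA.
rewrite !mxE -(inj_eq enum_val_inj) enum_rankK in lk *.
by rewrite (negbTE lk) mulr0.
Qed.

Definition perm_rep := MxRepresentation perm_rep_mx_repr.

Local Notation Xv u := ('X_(enum_rank u) : {mpoly F[#|{: c4c4}|]}).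

Lemma sym_act_perm g u : sym_act perm_rep g (Xv u) = Xv (f g * u)%g.
Proof.
rewrite sym_actXi (bigD1 (enum_rank (f g * u)%g)) //= big1 => [|l lk].
  by rewrite mxE !enum_rankK eqxx scale1r addr0.
rewrite mxE -(inj_eq enum_val_inj) !enum_rankK in lk *.
by rewrite (negbTE lk) scale0r.
Qed.

Local Notation K := (gauss F).

(** Two linear forms on the permutation module with values in F[i]: z_coef is
    supported on the powers of a, where it is the character sending a to i, and
    t_coef is the character with a in its kernel that sends b to i. Hence z is
    an eigenvector of a, and t is an eigenvector of both a and b. *)
Definition z_coef (u : c4c4) : K := if u.2 == 0 then gauss_i ^+ u.1 else 0.
Definition t_coef (u : c4c4) : K := gauss_i ^+ u.2.

Lemma gauss_i4 (S : comNzRingType) : (gauss_i : gauss S) ^+ 4 = 1.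
Proof.
rewrite -[4%N]/(2 * 2)%N exprM -[gauss_i ^+ 2]/(gauss_i * gauss_i).
by rewrite gauss_ii sqrrN expr1n.
Qed.

Lemma gauss_iD (r s : 'Z_4) :
  gauss_i ^+ (r + s)%R = gauss_i ^+ r * gauss_i ^+ s :> K.
Proof. by rewrite -exprD expr_mod // gauss_i4. Qed.

Lemma z_coef_a u : z_coef (c4c4_a * u)%g = gauss_i * z_coef u.
Proof.
case: u => r s; have -> : (c4c4_a * (r, s))%g = (1 + r, s) by rewrite c4c4M add0r.
rewrite /z_coef; cbn [fst snd].
by case: eqP => _; rewrite ?mulr0 // gauss_iD expr1.
Qed.

Lemma t_coef_a u : t_coef (c4c4_a * u)%g = t_coef u.
Proof. by rewrite /t_coef c4c4M add0r. Qed.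

Lemma t_coef_b u : t_coef (c4c4_b * u)%g = gauss_i * t_coef u.
Proof. by rewrite /t_coef c4c4M; cbn [fst snd c4c4_b]; rewrite gauss_iD expr1. Qed.

Definition const_zt : {rmorphism F -> {poly {poly K}}} :=
  polyC \o (polyC \o @gauss_re F).

Definition zt_form (i : 'I_#|{: c4c4}|) : {poly {poly K}} :=
  (z_coef (enum_val i))%:P%:P * 'X + (t_coef (enum_val i) *: 'X)%:P.

(** Specialization of the symmetric algebra to the two variables z (the outer
    one) and t (the inner one). *)
Definition spec_zt : {rmorphism {mpoly F[#|{: c4c4}|]} -> {poly {poly K}}} :=
  mmap const_zt zt_form.

Lemma spec_ztX u : spec_zt (Xv u) = (z_coef u)%:P%:P * 'X + (t_coef u *: 'X)%:P.
Proof. by rewrite /spec_zt /= mmapX mmap1U /zt_form enum_rankK. Qed.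

Lemma spec_ztC c : spec_zt c%:MP = (gauss_re c)%:P%:P.
Proof. by rewrite /spec_zt /= mmapC. Qed.

Lemma spec_zt_act_a g p : f g = c4c4_a ->
  spec_zt (sym_act perm_rep g p) = spec_zt p \Po (gauss_i%:P *: 'X).
Proof.
move=> fg; rewrite -[LHS]/((spec_zt \o sym_act perm_rep g) p).
rewrite -[RHS]/((comp_poly (gauss_i%:P *: 'X) \o spec_zt) p).
apply: mpoly_morph_ext => [c|i]; first by rewrite /= sym_actC spec_ztC comp_polyC.
rewrite /= -[i]enum_valK sym_act_perm fg !spec_ztX z_coef_a t_coef_a.
rewrite comp_polyD comp_polyM !comp_polyC comp_polyX; congr (_ + _).
by rewrite !polyCM -mul_polyC mulrA [gauss_i%:P%:P * _]mulrC.
Qed.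

Lemma spec_zt_act_b g p : f g = c4c4_b ->
  (spec_zt (sym_act perm_rep g p))`_0 = (spec_zt p)`_0 \Po (gauss_i *: 'X).
Proof.
move=> fg; rewrite -!horner_coef0.
rewrite -[LHS]/((horner_eval 0 \o (spec_zt \o sym_act perm_rep g)) p).
rewrite -[RHS]/((comp_poly (gauss_i *: 'X) \o (horner_eval 0 \o spec_zt)) p).
apply: mpoly_morph_ext => [c|i].
  by rewrite /= /horner_eval sym_actC spec_ztC hornerC comp_polyC.
rewrite /= /horner_eval -[i]enum_valK sym_act_perm fg !spec_ztX t_coef_b.
rewrite !hornerD !hornerM !hornerX !hornerC !mulr0 !add0r.
by rewrite comp_polyZ comp_polyX scalerA mulrC.
Qed.

Hypothesis two_neq0 : 2%:R != 0 :> F.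
Variables g_a g_b : gT.
Hypotheses (G_a : g_a \in G) (G_b : g_b \in G).
Hypotheses (f_a : f g_a = c4c4_a) (f_b : f g_b = c4c4_b).

Lemma gauss_half : exists h : K, h + h = 1.
Proof.
exists (gauss_re 2%:R^-1); rewrite -rmorphD -mulr2n -[_^-1 *+ 2]mulr_natl.
by rewrite mulfV // rmorph1.
Qed.

(** Invariance under a allows only powers of z whose exponent is divisible
    by 4. *)
Lemma spec_zt_z_coef0 p r : sym_invariant perm_rep p -> (0 < r < 4)%N ->
  (spec_zt p)`_r = 0.
Proof.
move=> p_inv r4; have [h hh] := gauss_half.
apply: (@gauss_fix0 _ gauss_i%:P h%:P _ r _ _ r4).
- by rewrite -polyCM gauss_ii polyCN.
- by rewrite -polyCD hh.
by rewrite -coef_comp_scaleX -(spec_zt_act_a p f_a) p_inv.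
Qed.

(** At z = 0 the specialization is equivariant for b as well, which allows only
    powers of t whose exponent is divisible by 4. *)
Lemma spec_zt_t_coef0 p r : sym_invariant perm_rep p -> (0 < r < 4)%N ->
  (spec_zt p)`_0`_r = 0.
Proof.
move=> p_inv r4; have [h hh] := gauss_half.
apply: (@gauss_fix0 _ gauss_i h _ r _ hh r4); first exact: gauss_ii.
by rewrite -coef_comp_scaleX -(spec_zt_act_b p f_b) p_inv.
Qed.

Definition z4t3_coef p : K := (spec_zt p)`_4`_3.

(** On invariants, the coefficient of z^4 t^3 is a derivation at the
    augmentation, so that it vanishes on decomposable invariants. *)
Lemma z4t3_coefM p q : sym_invariant perm_rep p -> sym_invariant perm_rep q ->
  z4t3_coef (p * q) =
    (spec_zt p)`_0`_0 * z4t3_coef q + z4t3_coef p * (spec_zt q)`_0`_0.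
Proof.
move=> p_inv q_inv; rewrite /z4t3_coef rmorphM; apply: coef43M => r r4.
- exact: spec_zt_z_coef0.
- exact: spec_zt_t_coef0.
- exact: spec_zt_t_coef0.
Qed.

Lemma degree_le_spec_zt d p : p \is d.-homog -> degree_le d (spec_zt p).
Proof.
move=> /dhomogP p_d; rewrite (mpolyE p) rmorph_sum big_seq /=.
elim/big_ind: _ => [|P Q Pd Qd|m /p_d <-] r s.
- by rewrite !coef0.
- by move=> rs; rewrite !coefD Pd // Qd // addr0.
rewrite -mul_mpolyC rmorphM spec_ztC !coefCM => rs.
suff -> : (spec_zt 'X_[m])`_r`_s = 0 by rewrite mulr0.
apply: (_ : degree_le (mdeg m) _) rs; rewrite /spec_zt /= mmapX /mmap1 mdegE.
elim/big_ind2: _ => [|P e1 Q e2|i _].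
- exact: degree_le1.
- exact: degree_leM.
by rewrite -{1}[m i]mul1n; apply/degree_leX/degree_le_linear.
Qed.

Lemma gen_subalg_z4t3 d p : (d <= 6)%N ->
  gen_subalg (low_degree_invariant perm_rep d) p ->
  sym_invariant perm_rep p /\ z4t3_coef p = 0.
Proof.
move=> d6; elim=> {p} [p [p_inv [k kd p_k]]|c|p q _ [pi p0] _ [qi q0]
    |p q _ [pi p0] _ [qi q0]].
- by split=> //; apply: (degree_le_spec_zt p_k); apply: leq_ltn_trans kd _.
- split=> [g Gg|]; first by rewrite -mul_mpolyC mulr1 sym_actC.
  by rewrite /z4t3_coef -mul_mpolyC mulr1 spec_ztC coefC coef0.
- split=> [g Gg|]; first by rewrite rmorphD /= pi // qi.
  by rewrite /z4t3_coef rmorphD !coefD [X in X + _]p0 [X in _ + X]q0 addr0.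
split=> [g Gg|]; first by rewrite rmorphM /= pi // qi.
by rewrite z4t3_coefM // p0 q0 mulr0 mul0r addr0.
Qed.

Definition test_invariant : {mpoly F[#|{: c4c4}|]} :=
  \sum_(u : c4c4) Xv u ^+ 4 * Xv (u * c4c4_b)%g ^+ 3.

Lemma test_invariantP : sym_invariant perm_rep test_invariant.
Proof.
move=> g Gg; rewrite /test_invariant rmorph_sum /=.
rewrite [RHS](reindex_inj (mulgI (f g))); apply: eq_bigr => u _.
by rewrite rmorphM !rmorphXn /= !sym_act_perm mulgA.
Qed.

(** A factor z comes only from a basis vector that is a power of a. The cube
    cannot provide four of them, so that u has to be such a power; then u b is
    not one, and contributes only t. *)
Lemma z4t3_coef_orbit u : z4t3_coef (Xv u ^+ 4 * Xv (u * c4c4_b)%g ^+ 3) =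
  if u.2 == 0 then gauss_i ^+ 3 else 0.
Proof.
have -> : (u * c4c4_b)%g = (u.1, u.2 + 1).
  by rewrite c4c4M /c4c4_sgn /= oppr0; case: ifP; rewrite addr0.
case: u => r s.
rewrite /z4t3_coef rmorphM !rmorphXn !spec_ztX /z_coef /t_coef.
cbn [fst snd]; have [->|s0] := eqVneq s 0.
  have -> : (0 + 1 == 0 :> 'Z_4) = false by [].
  rewrite polyC0 mul0r add0r -[_%:P ^+ 3]rmorphXn coefMC.
  rewrite coef_linear_pow // eqxx -[_%:P ^+ 4]rmorphXn coefCM.
  rewrite -exprM mulnC exprM gauss_i4 expr1n mul1r.
  by rewrite exprZn coefZ coefXn mulr1 add0r expr1.
rewrite polyC0 mul0r add0r -[_%:P ^+ 4]rmorphXn coefCM.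
by rewrite coef_linear_pow // mulr0 coef0.
Qed.

Lemma z4t3_test : z4t3_coef test_invariant = gauss_i ^+ 3 *+ 4.
Proof.
rewrite /test_invariant /z4t3_coef rmorph_sum !coef_sum.
under eq_bigr => u _ do rewrite -/(z4t3_coef _) z4t3_coef_orbit.
rewrite -big_mkcond sumr_const; congr (_ *+ _).
rewrite (eq_card (B := predX predT (pred1 (0 : 'Z_4)))) ?cardX ?card1 ?card_ord //.
Qed.

Lemma test_neq0 : gauss_i ^+ 3 *+ 4 != 0 :> K.
Proof.
have [h hh] := gauss_half.
have double0 (x : K) : x + x = 0 -> x = 0.
  by move=> xx; rewrite -[x]mul1r -hh mulrDl -mulrDr xx mulr0.
apply/eqP; rewrite -[4%N]/(2 * 2)%N mulrnA => /double0 /double0 i3.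
by have := oner_neq0 K; rewrite -(gauss_i4 F) exprSr i3 mul0r eqxx.
Qed.

Lemma perm_rep_degree d : invariants_generated_upto perm_rep d -> (7 <= d)%N.
Proof.
move=> gen; rewrite leqNgt ltnS; apply/negP => d6.
have [_ /eqP] := gen_subalg_z4t3 d6 (gen _ test_invariantP).
by rewrite z4t3_test (negbTE test_neq0).
Qed.

End LowerBound.

Local Close Scope ring_scope.

(** * The Noether number *)

(** The property need not be decidable, whence the classical case
    distinction. *)
Lemma is_least_exists (P : nat -> Prop) n :
  P n -> exists2 d, is_least P d & d <= n.
Proof.
elim/ltn_ind: n => n IHn Pn.
have [[m [m_n Pm]]|none] := classic (exists m, m < n /\ P m).
  by have [d Pd dm] := IHn m m_n Pm; exists d => //; apply: leq_trans dm (ltnW m_n).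
exists n => //; split=> // e Pe; rewrite leqNgt; apply/negP => e_n.
by apply: none; exists e.
Qed.

Theorem proposition3p1 (F : fieldType) (gT : finGroupType) (G : {group gT}) :
  (2%N \notin [pchar F])%R ->
  (G \isog Grp (a : b : a ^+ 4, b ^+ 4, b * a * b^-1 = a^-1))%g ->
  is_noether_number F G 7.
Proof.
rewrite inE /= => two_neq0 isoG; split=> [n rG|e e_bound].
  have /existsP[[a b] /eqP[G_gen a4 b4 ab]] := isoGrp_hom isoG.
  apply: is_least_exists.
  exact: (invariants_generated_upto7 G_gen a4 b4 ab two_neq0).
have := c4c4_homGrp; rewrite -isoG => /homgP[f fG].
have lift u : (u \in <[c4c4_a]> <*> <[c4c4_b]> -> exists2 g, g \in G & f g = u)%g.
  by rewrite -fG => /morphimP[g _ Gg ->]; exists g.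
have [|g_a G_a f_a] := lift c4c4_a; first by rewrite mem_gen // inE cycle_id.
have [|g_b G_b f_b] := lift c4c4_b; first by rewrite mem_gen // inE cycle_id orbT.
have [d [gen _] de] := e_bound _ (perm_rep F f).
exact: leq_trans (perm_rep_degree two_neq0 G_a G_b f_a f_b gen) de.
Qed.
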